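(* Let $X$ be a Banach space not containing $\ell_1$ with a basis $(e_i)_{i=1}^\infty$, and let $n\geq1$ be an integer. If $I(X)=\omega^n$, then $I_b(X)=\omega^m$ where $m=n$ or $m=n-1$. Here $I(X)$ is the Bourgain $\ell_1$-index of $X$ and $I_b(X)=I_b(X,(e_i))$ is the block basis $\ell_1$-index of $X$ with respect to $(e_i)$.
   Context: Banach spaces are real; $S(X)=\{x\in X:\|x\|=1\}$; ''not containing $\ell_1$'' means having no subspace isomorphic to $\ell_1$. A tree is a countable, non-empty, partially ordered set $(T,\leq)$ such that for each $x\in T$ the set $\{y\in T:y<x\}$ is linearly ordered and finite. A tree on a set $X$ is such a set $T\subseteq\bigcup_{n\ge1}X^n$ with the extension order: $(x_1,\dots,x_m)\leq(y_1,\dots,y_n)$ iff $m\leq n$ and $x_i=y_i$ for $i\leq m$. $D(T)=\{x\in T: x<y\text{ for some }y\in T\}$; $T^0=T$, $T^{\alpha+1}=D(T^\alpha)$, and $T^\alpha=\bigcap_{\beta<\alpha}T^\beta$ for limit $\alpha$. $T$ is well-founded if it contains no infinite linearly ordered subset; for well-founded $T$, the order is $o(T)=\inf\{\alpha:T^\alpha=\emptyset\}$. An $\ell_1$-$K$-tree on $X$ is a tree $T$ on $X$ with $T\subseteq\bigcup_{n\ge1}S(X)^n$ such that for each $(x_1,\dots,x_m)\in T$ there are constants $c,C>0$ with $c^{-1}C\leq K$ and $c\sum_1^m|a_i|\leq\|\sum_1^m a_ix_i\|\leq C\sum_1^m|a_i|$ for all real $(a_i)_1^m$. An $\ell_1$-$K$-block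 basis tree on $X$ with respect to $(e_i)$ is an $\ell_1$-$K$-tree each of whose nodes $(x_1,\dots,x_n)$ is a block basis of $(e_i)$ (non-zero finite linear combinations of the $e_i$ with successive supports). For $K\geq1$, $I(X,K)=\sup\{o(T):T\text{ is an }\ell_1\text{-}K\text{-tree on }X\}$ and $I(X)=\sup_{1\leq K<\infty}I(X,K)$. Likewise $I_b(X,K)=\sup\{o(T):T\text{ is an }\ell_1\text{-}K\text{-block basis tree on }X\text{ w.r.t. }(e_i)\}$ and $I_b(X)=\sup_{1\leq K<\infty}I_b(X,K)$. *)

(* Defs.v *)
From mathcomp Require Import all_boot all_order all_algebra.
From mathcomp Require Import all_classical all_reals all_analysis.
Set Implicit Arguments.
Unset Strict Implicit.
Unset Printing Implicit Defensive.
Import Order.TTheory GRing.Theory Num.Theory.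
Import numFieldNormedType.Exports.
Local Open Scope classical_set_scope.
Local Open Scope ring_scope.

(** [Ord f] denotes the least ordinal strictly above every [f x].  Distinct
    terms may denote the same ordinal: equality of ordinals is [oeq].
    Classes of ordinals are written [ord -> Prop]: [set ord] would force the
    universe of [set] above that of [ord], while suprema over families of
    trees, themselves sets, require the opposite. *)

Inductive ord : Type := Ord (A : Type) (f : A -> ord).

Fixpoint ole (a b : ord) : Prop :=
  match a, b with Ord A f, Ord B g => forall x, exists y, ole (f x) (g y) end.

Definition olt (a b : ord) : Prop :=
  match b with Ord B g => exists y, ole a (g y) end.

Definition oeq (a b : ord) : Prop := ole a b /\ ole b a.

Definition ozero : ord := Ord (fun v : void => match v with end).

Definition osucc (a : ord) : ord := Ord (fun _ : unit => a).

Definition olimit (a : ord) : Prop :=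
  olt ozero a /\ forall b, olt b a -> olt (osucc b) a.

Definition oindex (a : ord) : Type := match a with Ord A _ => A end.

Definition obelow (a : ord) : oindex a -> ord :=
  match a with Ord A f => f end.

Definition osup (A : Type) (f : A -> ord) : ord :=
  Ord (fun p : {x : A & oindex (f x)} => obelow (projT2 p)).

Definition is_least (P : ord -> Prop) (a : ord) : Prop :=
  P a /\ forall b, P b -> ole a b.

(* The junk value for unsatisfiable [P] is 0. *)
Definition oinf (P : ord -> Prop) : ord :=
  match pselect (exists a, is_least P a) with
  | left h => projT1 (cid h)
  | right _ => ozero
  end.

Fixpoint oadd (a b : ord) : ord :=
  match b with
  | Ord B g => osup (fun y : option B =>
      match y with None => a | Some y => osucc (oadd a (g y)) end)
  end.

Fixpoint omul (a b : ord) : ord :=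
  match b with Ord B g => osup (fun y => oadd (omul a (g y)) a) end.

Definition omega : ord := Ord (fun k : nat => iter k osucc ozero).

Definition omega_pow (n : nat) : ord :=
  iter n (fun a => omul a omega) (osucc ozero).

Lemma olexx a : ole a a.
Proof. by elim: a => A f ih /= x; exists x. Qed.

Lemma ole_trans b a c : ole a b -> ole b c -> ole a c.
Proof.
elim: a b c => A f ih [B g] [C h] /= ab bc x.
have [y xy] := ab x; have [z yz] := bc y.
by exists z; exact: ih xy yz.
Qed.

Lemma ole_lt_trans b a c : ole a b -> olt b c -> olt a c.
Proof. by case: c => C h ab [z bz]; exists z; exact: ole_trans bz. Qed.

Lemma olt_le_trans b a c : olt a b -> ole b c -> olt a c.
Proof.
case: b c => B g [C h] [y ay] bc.
by have [z yz] := bc y; exists z; exact: ole_trans yz.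
Qed.

Lemma ole_below a b : ole a b <-> forall x : oindex a, olt (obelow x) b.
Proof. by case: a b => A f [B g]. Qed.

Lemma oltW a b : olt a b -> ole a b.
Proof.
elim: a b => A f ih [B g] [y ay]; apply/ole_below => /= x.
exists y; apply: ih; apply: olt_le_trans ay.
by exists x; exact: olexx.
Qed.

Lemma oltS a : olt a (osucc a).
Proof. by exists tt; exact: olexx. Qed.

Lemma ole_succ a b : ole (osucc a) b <-> olt a b.
Proof. by split=> [/ole_below/(_ tt)|h] //; apply/ole_below. Qed.

Lemma oltS_le a b : olt a (osucc b) <-> ole a b.
Proof. by split=> [[]|h] //; exists tt. Qed.

Lemma olt0 a : ~ olt a ozero.
Proof. by case=> -[]. Qed.

Lemma ole0 a : ole ozero a.
Proof. by apply/ole_below => -[]. Qed.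

Lemma olt_wf : well_founded olt.
Proof.
suff H a b : ole b a -> Acc olt b by move=> a; exact: H (olexx a).
elim: a b => A f ih b ba; constructor=> c cb.
have [x cx] := olt_le_trans cb ba.
exact: ih cx.
Qed.

Lemma olt_irr a : ~ olt a a.
Proof.
by elim: (olt_wf a) => {}a _ ih aa; exact: (ih a aa aa).
Qed.

Lemma ole_total a b : ole a b \/ olt b a.
Proof.
elim: a b => A f iha b.
have [h|/existsNP[x hx]] := pselect (forall x, olt (f x) b).
  by left; apply/ole_below.
right; exists x; elim: b hx => B g ihb hx.
apply/ole_below => /= y; have [xy|//] := iha x (g y).
by case: hx; exists y.
Qed.

Lemma osup_ub (A : Type) (f : A -> ord) x : ole (f x) (osup f).
Proof.
by apply/ole_below => y; exists (existT _ x y) => /=; exact: olexx.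
Qed.

Lemma osup_least (A : Type) (f : A -> ord) b :
  (forall x, ole (f x) b) -> ole (osup f) b.
Proof.
by move=> fb; apply/ole_below => -[x y] /=; have /ole_below := fb x; apply.
Qed.

Lemma oadd0 a : oeq (oadd a ozero) a.
Proof.
split; last exact: (@osup_ub _ _ None).
by apply: osup_least => -[[]|]; exact: olexx.
Qed.

Lemma oaddS a b : oeq (oadd a (osucc b)) (osucc (oadd a b)).
Proof.
split; last exact: (@osup_ub _ _ (Some tt)).
apply: osup_least => -[_|]; first exact: olexx.
apply: (@ole_trans (oadd a b)); last exact/oltW/oltS.
by case: b => B g; exact: (@osup_ub _ _ None).
Qed.

Lemma omul0 a : oeq (omul a ozero) ozero.
Proof. by split; [apply: osup_least => -[]|exact: ole0]. Qed.

Lemma omulS a b : oeq (omul a (osucc b)) (oadd (omul a b) a).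
Proof.
split; last exact: (@osup_ub _ _ tt).
by apply: osup_least => _; exact: olexx.
Qed.

Lemma ex_least (P : ord -> Prop) a : P a -> exists b, is_least P b.
Proof.
elim: (olt_wf a) => {}a _ ih Pa.
have [[b [ba Pb]]|h] := pselect (exists b, olt b a /\ P b); first exact: (ih b).
exists a; split=> // b Pb; have [//|ba] := ole_total a b.
by case: h; exists b.
Qed.

Lemma oinfP (P : ord -> Prop) a : P a -> is_least P (oinf P).
Proof.
move=> Pa; rewrite /oinf; case: pselect => [h|[]]; last exact: ex_least Pa.
exact: projT2 (cid h).
Qed.

Section Trees.
Context {U : Type} (le : U -> U -> Prop).
Implicit Types (T : set U) (a b : ord).

Definition slt (x y : U) : Prop := le x y /\ x <> y.

Definition is_tree T : Prop :=
  [/\ countable T, T !=set0,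
      [/\ forall x, T x -> le x x,
          forall x y, T x -> T y -> le x y -> le y x -> x = y &
          forall x y z, T x -> T y -> T z -> le x y -> le y z -> le x z] &
      forall x, T x ->
        finite_set [set y | T y /\ slt y x] /\
        forall y z, T y -> T z -> slt y x -> slt z x -> le y z \/ le z y].

Definition D T : set U := [set x | T x /\ exists2 y, T y & slt x y].

(* T^a is given by the uniform recursion T^a = T `&` \bigcap_(b < a) D (T^b);
   [derived0], [derivedS] and [derived_lim] below are the usual three clauses
   of the transfinite definition. *)
Fixpoint derived T a : set U :=
  match a with Ord A f => [set t | T t /\ forall x, D (derived T (f x)) t] end.

(* o(T) is only meaningful when T is well-founded; for other T no derived
   tree is empty and the value is the junk value 0 of [oinf]. *)
Definition tree_order T : ord := oinf (fun a => derived T a = set0).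

Lemma DS T T' : T `<=` T' -> D T `<=` D T'.
Proof.
move=> TT' x [Tx [y Ty xy]]; split; first exact: TT'.
by exists y => //; exact: TT'.
Qed.

Lemma derived_le T a b : ole a b -> derived T b `<=` derived T a.
Proof.
elim: a b => A f ih [B g] ab t /= [Tt h]; split=> // x.
by have [y xy] := ab x; exact: DS (ih _ _ xy) _ (h y).
Qed.

Lemma derived_lt T a b : olt b a -> derived T a `<=` D (derived T b).
Proof. by case: a => A f [x bx] t [_ /(_ x)]; exact: DS (derived_le bx) t. Qed.

Lemma derived0 T : derived T ozero = T.
Proof. by apply/seteqP; split=> t /= => [[]|]. Qed.

Lemma derivedS T a : derived T (osucc a) = D (derived T a).
Proof.
apply/seteqP; split=> t; first by move=> [_ /(_ tt)].
by move=> h; split=> //; case: h => + _; case: a => A f [].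
Qed.

Lemma derived_lim T a : olimit a ->
  derived T a = [set t | forall b, olt b a -> derived T b t].
Proof.
move=> [a_gt0 lim_a]; apply/seteqP; split=> t.
  by move=> ta b /oltW/derived_le; exact.
move=> h; have Tt : T t by have := h _ a_gt0; rewrite derived0.
case: a a_gt0 lim_a h => A f _ lim_a h; split=> // x.
rewrite -derivedS; apply: h; apply: lim_a.
by exists x; exact: olexx.
Qed.

Lemma oeq_derived T a b : oeq a b -> derived T a = derived T b.
Proof. by move=> [ab ba]; apply/seteqP; split; exact: derived_le. Qed.

End Trees.

Section Banach.
Context {R : realType}.

Definition l1 : set (nat -> R) :=
  [set a : nat -> R | cvgn (series (fun i => `|a i|))].

Definition l1_norm (a : nat -> R) : R := limn (series (fun i => `|a i|)).

(* The subspace isomorphic to l1 is the range of [J] on [l1]. *)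
Definition contains_l1 (X : completeNormedModType R) : Prop :=
  exists J : (nat -> R) -> X,
    (forall (k : R) a b, l1 a -> l1 b ->
       J (fun i => k * a i + b i) = k *: J a + J b) /\
    exists c C : R, [/\ 0 < c, 0 < C &
      forall a, l1 a -> c * l1_norm a <= `|J a| <= C * l1_norm a].

Context {X : completeNormedModType R}.

Definition schauder_basis (e : nat -> X) : Prop :=
  forall x : X, exists! a : nat -> R, series (fun i => a i *: e i) @ \oo --> x.

(* [c j] lists the coefficients of the j-th term of [s] in [e]. *)
Definition block_basis (e : nat -> X) (s : seq X) : Prop :=
  exists (N : nat) (c : nat -> nat -> R),
    (forall j, (j < size s)%N ->
       s`_j = \sum_(i < N) c j i *: e i /\ s`_j <> 0) /\
    (forall j k, (j < k)%N -> (k < size s)%N ->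
       forall i i', (i < N)%N -> (i' < N)%N ->
         c j i <> 0 -> c k i' <> 0 -> (i < i')%N).

Definition seq_le (s t : seq X) : Prop := prefix s t.

Definition tree_on (T : set (seq X)) : Prop :=
  (forall s, T s -> s <> [::]) /\ is_tree seq_le T.

Definition l1_tree (K : R) (T : set (seq X)) : Prop :=
  tree_on T /\ forall s, T s ->
    (forall x, x \in s -> `|x| = 1) /\
    exists c C : R, [/\ 0 < c, 0 < C, c^-1 * C <= K &
      forall a : nat -> R,
        c * (\sum_(i < size s) `|a i|) <= `|\sum_(i < size s) a i *: s`_i|
          <= C * (\sum_(i < size s) `|a i|)].

Definition block_l1_tree (e : nat -> X) (K : R) (T : set (seq X)) : Prop :=
  l1_tree K T /\ forall s, T s -> block_basis e s.

End Banach.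

Definition l1_index_K (R : realType) (X : completeNormedModType R) (K : R) :=
  osup (fun T : {T : set (seq X) | l1_tree K T} => tree_order seq_le (sval T)).

Definition l1_index (R : realType) (X : completeNormedModType R) :=
  osup (fun K : {K : R | 1 <= K} => l1_index_K X (sval K)).

Definition block_l1_index_K (R : realType) (X : completeNormedModType R)
    (e : nat -> X) (K : R) :=
  osup (fun T : {T : set (seq X) | block_l1_tree e K T} =>
    tree_order seq_le (sval T)).

Definition block_l1_index (R : realType) (X : completeNormedModType R)
    (e : nat -> X) :=
  osup (fun K : {K : R | 1 <= K} => block_l1_index_K e (sval K)).

(* Main.v *)
Require Import Defs.
From mathcomp Require Import all_boot all_order all_algebra.
From mathcomp Require Import all_classical all_reals all_analysis.
From mathcomp Require Import ring lra.
Set Implicit Arguments.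
Unset Strict Implicit.
Unset Printing Implicit Defensive.
Import Order.TTheory GRing.Theory Num.Theory.
Import numFieldNormedType.Exports.
Local Open Scope classical_set_scope.
Local Open Scope ring_scope.

(** Notation: I and I_b stand for the index and the block basis index of X.

    A set A of finite sequences that contains the empty sequence is ranked at
    this root: [::] lies in the b-th derived set of A exactly when, for every
    c < b, the c-th derived set of A has a non-empty member. If the set of
    non-empty members is a well-founded tree, this says that its order is at
    least b. Ranks are computed in the full sets [l1_nodes K] and
    [block_nodes e K N] of nodes with constant K, the second one consisting of
    blocks supported from the index N on; a countable tree is extracted only at
    the end ([derived_countable]), and it is well-founded because X does not
    contain l1 ([l1_nodes_wf]).

    Block trees are l1-trees, so I_b <= I = omega^n. Two facts exclude all
    values other than omega^(n-1) and omega^n.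

    Passing to blocks divides ranks by omega, so that I_b >= omega^(n-1). If the
    blocks chosen so far end at the index L, then more than L new vectors of an
    l1-node have a non-trivial combination whose first L coordinates vanish;
    normalising and truncating it gives one more block. Blocks of an l1-sequence
    satisfy the same lower estimate, and a uniformly small perturbation of each
    block costs a factor 2 ([shadow_ext], [derived_shadow]). Each step uses
    finitely many vectors, but their number is not bounded in advance: this is
    why omega levels are spent for each block. For n = 1 a single basis vector
    is enough.

    There is no value strictly between omega^m and omega^(m+1). If
    I_b > omega^m, one block tree has rank omega^m; dropping first vectors of
    its nodes, the same rank is attained beyond every index with the same
    constant ([derived_block_tail]); for m = 0 normalised basis vectors do the
    same ([cofinal_rank1]). Such sets can be glued end to end, and the
    basis constant bounds the loss in the l1 estimate ([block_nodes_cat]), so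
    the ranks omega^m * k are attained for all k ([cofinal_rank_mul_omega]). The
    constant grows with k, which is harmless as I_b is a supremum over all
    constants. *)

(** * Ordinal arithmetic *)

(** Comparing ordinals through their strict predecessors avoids unfolding the
    index types of [oadd] and [omul]. *)
Lemma ole_of_olt a b : (forall c, olt c a -> olt c b) -> ole a b.
Proof.
move=> h; apply/ole_below => x; apply: h.
by have /ole_below := olexx a; apply.
Qed.

Lemma olt_osup (A : Type) (f : A -> ord) b :
  olt b (osup f) <-> exists x, olt b (f x).
Proof.
split=> [[[x y] /= h]|[x h]].
  by exists x; case: (f x) y h => B g y h; exists y.
exact: olt_le_trans h (osup_ub f x).
Qed.

Lemma ole_osup (A : Type) (f : A -> ord) b x : ole b (f x) -> ole b (osup f).
Proof. by move=> h; exact: ole_trans h (osup_ub f x). Qed.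

Lemma osucc_le a b : ole a b -> ole (osucc a) (osucc b).
Proof. by move=> h; apply/ole_succ/oltS_le. Qed.

Lemma oadd_ge a b : ole a (oadd a b).
Proof. by case: b => B g; exact: (@osup_ub _ _ None). Qed.

Lemma oaddE a (B : Type) (g : B -> ord) :
  oadd a (Ord g) = osup (fun y : option B =>
    if y is Some y then osucc (oadd a (g y)) else a).
Proof. by []. Qed.

Lemma omulE a (B : Type) (g : B -> ord) :
  omul a (Ord g) = osup (fun y => oadd (omul a (g y)) a).
Proof. by []. Qed.

Lemma oadd_ler a b c : ole b c -> ole (oadd a b) (oadd a c).
Proof.
elim: b c => B g ih [C h] bc; rewrite !oaddE; apply: osup_least => -[y|].
  have [z yz] := bc y.
  by apply: (@ole_osup _ _ _ (Some z)); exact/osucc_le/ih.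
exact: (@ole_osup _ _ _ None (olexx _)).
Qed.

Lemma olt_oadd a b c :
  olt c (oadd a b) <-> olt c a \/ exists2 d, olt d b & ole c (oadd a d).
Proof.
case: b => B g; rewrite oaddE olt_osup; split.
  move=> [[y|] h]; last by left.
  by right; exists (g y); [exists y; exact: olexx|exact/oltS_le].
move=> [h|[d [y dy] h]]; first by exists None.
by exists (Some y); apply/oltS_le; apply: ole_trans h _; exact: oadd_ler.
Qed.

Lemma oadd_ltr a b c : olt b c -> olt (oadd a b) (oadd a c).
Proof. by move=> bc; apply/olt_oadd; right; exists b => //; exact: olexx. Qed.

Lemma oadd_lel a b c : ole a b -> ole (oadd a c) (oadd b c).
Proof.
move=> ab; elim: c => C g ih; rewrite !oaddE; apply: osup_least => -[y|].
  by apply: (@ole_osup _ _ _ (Some y)); exact/osucc_le/ih.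
exact: (@ole_osup _ _ _ None).
Qed.

Lemma oaddA_le a b c : ole (oadd (oadd a b) c) (oadd a (oadd b c)).
Proof.
elim: c => C g ih; rewrite oaddE; apply: osup_least => -[y|]; last first.
  by apply: oadd_ler; exact: oadd_ge.
apply/ole_succ; apply: ole_lt_trans (ih y) _; apply: oadd_ltr.
by apply: (@oadd_ltr _ _ (Ord g)); exists y; exact: olexx.
Qed.

Lemma oadd_gel a b : ole b (oadd a b).
Proof.
elim: b => B g ih; apply/ole_below => y; apply/olt_oadd.
by right; exists (g y); [exists y; exact: olexx|exact: ih].
Qed.

Lemma omul_ge1 a b : olt ozero b -> ole a (omul a b).
Proof.
by case: b => B g [y _]; apply: (@ole_osup _ _ _ y); exact: oadd_gel.
Qed.

Lemma omul_below a (B : Type) (g : B -> ord) y :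
  ole (oadd (omul a (g y)) a) (omul a (Ord g)).
Proof. exact: (@osup_ub _ (fun y => oadd (omul a (g y)) a)). Qed.

Lemma omulr_le a b c : ole b c -> ole (omul a b) (omul a c).
Proof.
elim: b c => B g ih [C h] bc; rewrite !omulE; apply: osup_least => y.
have [z yz] := bc y; apply: (@ole_osup _ _ _ z).
by apply: oadd_lel; exact: ih.
Qed.

Lemma omull_le a b c : ole a b -> ole (omul a c) (omul b c).
Proof.
move=> ab; elim: c => C g ih; rewrite !omulE; apply: osup_least => y.
apply: (@ole_osup _ _ _ y); apply: ole_trans (oadd_lel _ (ih y)) _.
exact: oadd_ler.
Qed.

Lemma olt_omul a b c :
  olt c (omul a b) <-> exists2 d, olt d b & olt c (oadd (omul a d) a).
Proof.
case: b => B g; rewrite omulE olt_osup; split=> [[y h]|[d [y dy] h]].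
  by exists (g y) => //; exists y; exact: olexx.
exists y; apply: olt_le_trans h _.
by apply: oadd_lel; exact: omulr_le.
Qed.

Lemma omul_succ_lt a b c : olt b c -> ole (oadd (omul a b) a) (omul a c).
Proof.
by move=> bc; apply: ole_of_olt => d h; apply/olt_omul; exists b.
Qed.

Lemma omulDr_le a b c :
  ole (omul a (oadd b c)) (oadd (omul a b) (omul a c)).
Proof.
elim: c => C g ih; apply: ole_of_olt => x /olt_omul[d + h].
move=> /olt_oadd[db|[c' [y c'y] dc]]; apply: olt_le_trans h _.
  apply: ole_trans (oadd_ge _ _); exact: omul_succ_lt.
have {dc} dc : ole d (oadd b (g y)) by apply: ole_trans dc (oadd_ler _ _).
apply: ole_trans (oadd_lel _ (omulr_le a dc)) _.
apply: ole_trans (oadd_lel _ (ih y)) _.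
apply: ole_trans (oaddA_le _ _ _) _.
by apply: oadd_ler; exact: omul_below.
Qed.

(** It suffices to compare the finite stages [omul b k] of [omul b omega], on
    which distributivity applies [k] times. *)
Lemma omulA_omega_le a b :
  ole (omul a (omul b omega)) (omul (omul a b) omega).
Proof.
have fin k : ole (omul a (omul b (iter k osucc ozero)))
                 (omul (omul a b) (iter k osucc ozero)).
  elim: k => [|k ih].
    apply: ole_trans (omulr_le a (proj1 (omul0 b))) _.
    exact: ole_trans (proj1 (omul0 a)) (ole0 _).
  rewrite !iterS; apply: ole_trans (omulr_le a (proj1 (omulS b _))) _.
  apply: ole_trans (omulDr_le _ _ _) _.
  by apply: ole_trans (proj2 (omulS _ _)); exact: oadd_lel.
apply: ole_of_olt => x /olt_omul[d + h].
move=> /olt_omul[d' [k dk] dk']; apply: olt_le_trans h _.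
have {dk'} dk' : ole (osucc d) (omul b (iter k.+1 osucc ozero)).
  apply/ole_succ; apply: olt_le_trans dk' _.
  by apply: omul_succ_lt; rewrite iterS; exact/oltS_le.
apply: ole_trans (proj2 (omulS _ _)) _.
apply: ole_trans (omulr_le a dk') _; apply: ole_trans (fin _) _.
by apply: omulr_le; apply/oltW; exists k.+1; exact: olexx.
Qed.

Lemma omega_powS m : omega_pow m.+1 = omul (omega_pow m) omega.
Proof. by []. Qed.

(** The left factor omega can be moved to the right because every power of omega
    is itself an iterated product of omegas; only the base case, omega times 1
    against 1 times omega, is not associativity. *)
Lemma omul_omega_pow_le m : ole (omul omega (omega_pow m)) (omega_pow m.+1).
Proof.
elim: m => [|m ih]; last first.
  rewrite 2!omega_powS; apply: ole_trans (@omulA_omega_le _ _) _.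
  exact: omull_le.
apply: ole_of_olt => x /olt_omul[d d0 /olt_oadd[h|[d' [k dk] h]]].
  case: (@olt0 x); apply: olt_le_trans h _; apply: ole_trans (proj1 (omul0 omega)).
  by apply: omulr_le; exact/oltS_le.
have {}d0 : ole d ozero by exact/oltS_le.

apply: (@ole_lt_trans (iter k osucc ozero)).
  apply: ole_trans h _; apply: ole_trans (oadd_ler _ dk) _.
  elim: k {dk} => [|k ih].
    exact: ole_trans (proj1 (oadd0 _)) (ole_trans (omulr_le _ d0) (proj1 (omul0 _))).
  by rewrite iterS; apply: ole_trans (proj1 (oaddS _ _)) _; exact: osucc_le.
have le j : ole (iter j osucc ozero) (omul (osucc ozero) (iter j osucc ozero)).
  elim: j => [|j ih]; first exact: ole0.
  rewrite iterS; apply: ole_trans (proj2 (omulS _ _)).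
  apply: ole_trans (proj2 (oaddS _ _)); apply: osucc_le.
  exact: ole_trans ih (oadd_ge _ _).
apply: olt_le_trans (_ : ole (iter k.+1 osucc ozero) _).
  by rewrite iterS; exact: oltS.
apply: ole_trans (le _) _; apply: omulr_le.
by apply/oltW; exists k.+1; exact: olexx.
Qed.

Lemma omega_pow_gt0 m : olt ozero (omega_pow m).
Proof.
elim: m => [|m ih]; first exact: oltS.
rewrite omega_powS; apply: olt_le_trans ih _; apply: omul_ge1.
by exists 0%N; exact: olexx.
Qed.

(** Below [omega_pow m * omega] there is always room for one more copy of
    [omega_pow m], and that copy is non-zero. *)
Lemma omega_pow_limit m b :
  olt b (omega_pow m.+1) -> olt (osucc b) (omega_pow m.+1).
Proof.
rewrite omega_powS; set a := omega_pow m => /olt_omul[d [k dk] h].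
apply/olt_omul; exists (iter k.+1 osucc ozero); first by exists k.+1; exact: olexx.
apply: (@ole_lt_trans (omul a (iter k.+1 osucc ozero))); last first.
  apply: ole_lt_trans (proj2 (oadd0 _)) _; apply: oadd_ltr.
  exact: omega_pow_gt0.
apply/ole_succ; rewrite iterS; apply: olt_le_trans h _.
by apply: ole_trans (proj2 (omulS _ _)); apply: oadd_lel; exact: omulr_le.
Qed.

(** * Hereditarily countable ordinals *)

(** Trees are countable, whereas the sets of nodes ranked below are not: an
    ordinal can be attained by a countable subtree only if it is assembled from
    countable families at every level. An enumeration through [option] covers
    the empty index type. *)
Fixpoint hcountable (a : ord) : Prop :=
  match a with Ord A f =>
    (exists h : nat -> option A, forall x, exists k, h k = Some x) /\
    forall x, hcountable (f x)
  end.

Lemma hcountable_osup (A : Type) (f : A -> ord) :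
  (exists h : nat -> option A, forall x, exists k, h k = Some x) ->
  (forall x, hcountable (f x)) -> hcountable (osup f).
Proof.
move=> [h hP] hf; split; last first.
  by move=> [x y] /=; move: (hf x) y; case: (f x) => B g [] _ h' y; exact: h'.
have ex x : exists q : nat -> option (oindex (f x)),
    forall y, exists k, q k = Some y.
  by have := hf x; case: (f x) => B g [].
pose q x := projT1 (cid (ex x)); have qP x := projT2 (cid (ex x)).
exists (fun k => match @unpickle (nat * nat)%type k with
  | Some (i, j) => match h i with
    | Some x => omap (fun y => existT _ x y) (q x j) | None => None end
  | None => None end).
move=> [x y]; have [i hi] := hP x; have [j qj] := qP x y.
by exists (pickle (i, j)); rewrite pickleK hi /q qj.
Qed.

Lemma hcountable_succ a : hcountable a -> hcountable (osucc a).
Proof. by move=> ha; split=> // ; exists (fun=> Some tt) => -[]; exists 0%N. Qed.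

Lemma hcountable_add a b : hcountable a -> hcountable b -> hcountable (oadd a b).
Proof.
move=> ha; elim: b => B g ih [[h hP] hg]; rewrite oaddE.
apply: hcountable_osup => [|[y|//]]; last by apply/hcountable_succ/ih/hg.
exists (fun k => if k is j.+1 then omap Some (h j) else Some None).
by move=> [y|]; [have [k hk] := hP y; exists k.+1; rewrite hk|exists 0%N].
Qed.

Lemma hcountable_mul a b : hcountable a -> hcountable b -> hcountable (omul a b).
Proof.
move=> ha; elim: b => B g ih [hB hg]; rewrite omulE.
apply: hcountable_osup => // y.
by apply: hcountable_add => //; apply/ih/hg.
Qed.

Lemma hcountable0 : hcountable ozero.
Proof. by split=> [|[]]; exists (fun=> None) => -[]. Qed.

Lemma hcountable_nat k : hcountable (iter k osucc ozero).
Proof. by elim: k => [|k ih]; [exact: hcountable0|exact: hcountable_succ]. Qed.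

Lemma hcountable_omega_pow m : hcountable (omega_pow m).
Proof.
elim: m => [|m ih]; first exact/hcountable_succ/hcountable0.
apply: hcountable_mul => //; split=> [|k]; last exact: hcountable_nat.
by exists Some => k; exists k.
Qed.

Lemma hcountable_below a x : hcountable a -> hcountable (@obelow a x).
Proof. by case: a x => A f x [_ h]; exact: h. Qed.
(** * Ranks of finite sequences *)

Section SeqTrees.
Context {R : realType} {X : completeNormedModType R}.
Implicit Types (A B T : set (seq X)) (s t u : seq X) (a b : ord).

Local Notation drv := (derived (@seq_le R X)).
Local Notation ext := (slt (@seq_le R X)).

Lemma extP s t : ext s t <-> exists2 u, u <> [::] & t = s ++ u.
Proof.
split=> [[/prefixP[u ->] h]|[u u0 ->]].
  by exists u => // u0; apply: h; rewrite u0 cats0.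
split; first exact: prefix_prefix.
by move=> /(congr1 size)/eqP; rewrite size_cat -{1}[size s]addn0 eqn_add2l;
  case: u u0.
Qed.

Lemma derived_sub A a : drv A a `<=` A.
Proof. by case: a => B f t []. Qed.

Lemma derived_down A a s t : A s -> ext s t -> drv A a t -> drv A a s.
Proof.
move=> As st; elim: a => B f ih ta; split=> // x.
have tx : drv A (f x) t by case: (ta) => _ /(_ x) [].
by split; [exact: ih|exists t].
Qed.

Lemma derivedP A a s :
  drv A a s <-> A s /\ forall b, olt b a -> exists2 t, ext s t & drv A b t.
Proof.
split=> [h|[As h]].
  split; first exact: derived_sub h.
  by move=> b ba; have [_ [t ? ?]] := derived_lt ba h; exists t.
case: a h => B f h; split=> // x; have fx : olt (f x) (Ord f) by exists x; exact: olexx.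
have [t st ht] := h _ fx.
by split; [exact: derived_down st ht|exists t].
Qed.

(** Ranks are transported along a simulation: a relation that can follow every
    proper extension on the left by a proper extension on the right. *)
Lemma derived_sim A B (P : seq X -> seq X -> Prop) :
    (forall s t, P s t -> B t) ->
    (forall s t s', P s t -> A s' -> ext s s' -> exists2 t', ext t t' & P s' t') ->
  forall a s t, P s t -> drv A a s -> drv B a t.
Proof.
move=> PB Pext; elim/(well_founded_ind olt_wf) => a ih s t st /derivedP[As h].
apply/derivedP; split=> [|b ba]; first exact: PB st.
have [s' ss' s'b] := h b ba.
have [t' tt' s't'] := Pext _ _ _ st (derived_sub s'b) ss'.
by exists t' => //; exact: ih s't' s'b.
Qed.

Lemma derived_mono A B a : A `<=` B -> drv A a `<=` drv B a.
Proof.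
move=> AB s h; apply: (@derived_sim A B (fun s t => s = t /\ A s)) (h).
- by move=> s' t [<-]; exact: AB.
- by move=> s1 t s' [<- _] As' ss'; exists s'.
- by split=> //; exact: derived_sub h.
Qed.

(** Each of the [k] extra derivations forces one more extension, hence at least
    one more vector. *)
Lemma derived_add_nat A a k s : drv A (oadd a (iter k osucc ozero)) s ->
  exists2 u, (k <= size u)%N & drv A a (s ++ u).
Proof.
elim: k s => [|k ih] s h.
  by exists [::]; rewrite ?cats0 //; exact: derived_le (proj2 (oadd0 a)) _ h.
have := derived_le (proj2 (oaddS _ _)) h; rewrite derivedS => -[_ [t + /extP[v v0 st]]].
rewrite {t}st => /ih[u ku {}h]; exists (v ++ u); last first.
  by rewrite catA.
by rewrite size_cat; case: v v0 {h} => //= x v _; rewrite addSn ltnS (leq_trans ku) ?leq_addl.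
Qed.

(** A simulation that only follows extensions by at least [k] vectors, with [k]
    depending on the current pair, divides the rank by omega: between
    consecutive multiples of omega there is room for any finite number of
    extensions. *)
Lemma derived_omega_sim A B (P : seq X -> seq X -> Prop) :
    (forall s t, P s t -> B t) ->
    (forall s t, P s t -> exists k, forall u, A (s ++ u) -> (k <= size u)%N ->
      exists2 t', ext t t' & P (s ++ u) t') ->
  forall a s t, P s t -> drv A (omul omega a) s -> drv B a t.
Proof.
move=> PB Pext; elim/(well_founded_ind olt_wf) => a ih s t st h.
apply/derivedP; split=> [|b ba]; first exact: PB st.
have [k Pk] := Pext _ _ st.
have [u ku sub] : exists2 u, (k <= size u)%N & drv A (omul omega b) (s ++ u).
  apply: derived_add_nat.
  apply: derived_le h; apply: ole_trans (omul_succ_lt omega ba).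
  by apply/oadd_ler/oltW; exists k; exact: olexx.
have [t' tt' ut'] := Pk u (derived_sub sub) ku.
by exists t' => //; exact: ih ut' sub.
Qed.

(** Gluing a set of rank [b] on top of every node of a set of rank [a] gives
    rank [b + a]: derivation strips the upper parts first, so the rank of what
    is added on top stands on the left of the sum. *)
Lemma derived_cat A C (F : seq X -> set (seq X)) b :
    (forall s, A s -> drv (F s) b [::]) ->
    (forall s u, A s -> F s u -> C (s ++ u)) ->
  forall a s, drv A a s -> drv C (oadd b a) s.
Proof.
move=> Fb FC; elim/(well_founded_ind olt_wf) => a ih s h.
have As : A s by exact: derived_sub h.
have sb : drv C b s.
  apply: (@derived_sim (F s) C (fun u t => F s u /\ t = s ++ u)) (Fb s As).
  - by move=> u _ [Fu ->]; exact: FC.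
  - move=> u t w [_ ->] Fw /extP[v v0 wE]; exists (s ++ w); last by [].
    by apply/extP; exists v; rewrite ?wE ?catA.
  - by split; [exact: derived_sub (Fb s As)|rewrite cats0].
apply/derivedP; split=> [|c /olt_oadd[cb|[d da cd]]].
- exact: derived_sub sb.
- by move/derivedP: sb => [_]; exact.
- move/derivedP: h => [_ /(_ d da)[t st td]]; exists t => //.
  by apply: derived_le cd _ _; exact: ih.
Qed.

(** A countable witness is collected by choosing, for each of the countably many
    smaller ranks, one extension and, recursively, a witness for it. *)
Lemma derived_countable A a s : hcountable a -> drv A a s ->
  exists T, [/\ countable T, T `<=` A & drv T a s].
Proof.
elim: a s => C f ih s [[h hP] hf] sa; have As : A s := derived_sub sa.
have /choice[F FP] k : exists T, [/\ countable T, T `<=` A &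
    if h k is Some x then exists2 t, ext s t & drv T (f x) t else True].
  case: (h k) => [x|]; last by exists set0; split.
  have [_ [t tx st]] := proj2 sa x.
  by have [T [Tc TA Tt]] := ih x t (hf x) tx; exists T; split=> //; exists t.
pose G k := if k is Some k then F k else [set s].
exists (\bigcup_k G k); split.
- by apply: bigcup_countable => // -[k|] _; [have [] := FP k|exact: countable1].
- by move=> t [[k|] _ /=]; [have [_ + _] := FP k; exact|move=> ->].
- split=> [|x]; first by exists None.
  have [k hk] := hP x; have [_ _] := FP k; rewrite hk => -[t st tx].
  have tx' : drv (\bigcup_k G k) (f x) t.
    by apply: derived_mono tx => u Fu; exists (Some k).
  by split; [apply: derived_down st tx'; exists None|exists t].
Qed.

End SeqTrees.
(** * Nodes of l1-trees *)

Section L1Nodes.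
Context {R : realType} {X : completeNormedModType R}.
Implicit Types (K : R) (a : nat -> R) (s t : seq X).

Definition lincomb a s : X := \sum_(i < size s) a i *: s`_i.

Definition l1sum a n : R := \sum_(i < n) `|a i|.

(** A normalised sequence with two-sided constants [C / c <= K] satisfies this
    one-sided estimate, the upper one being the triangle inequality. The empty
    sequence belongs to it and serves as a root. *)
Definition l1_nodes K : set (seq X) :=
  [set s : seq X | (forall x, x \in s -> `|x| = 1) /\
           forall a, l1sum a (size s) <= K * `|lincomb a s|].

Lemma lincomb_cat a s t :
  lincomb a (s ++ t) = lincomb a s + lincomb (fun i => a (size s + i)%N) t.
Proof.
rewrite /lincomb size_cat big_split_ord /=; congr (_ + _).
  by apply: eq_bigr => i _; rewrite nth_cat ltn_ord.
by apply: eq_bigr => i _; rewrite nth_cat ltnNge leq_addr /= addKn.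
Qed.

Lemma l1sum_add a m n :
  l1sum a (m + n) = l1sum a m + l1sum (fun i => a (m + i)%N) n.
Proof. by rewrite /l1sum big_split_ord. Qed.

Lemma eq_lincomb a b s : (forall i, (i < size s)%N -> a i = b i) ->
  lincomb a s = lincomb b s.
Proof. by move=> ab; apply: eq_bigr => i _; rewrite ab. Qed.

Lemma eq_l1sum a b n : (forall i, (i < n)%N -> a i = b i) ->
  l1sum a n = l1sum b n.
Proof. by move=> ab; apply: eq_bigr => i _; rewrite ab. Qed.

Lemma lincomb_le a s : (forall x, x \in s -> `|x| = 1) ->
  `|lincomb a s| <= l1sum a (size s).
Proof.
move=> s1; apply: le_trans (ler_norm_sum _ _ _) _; apply: ler_sum => i _.
by rewrite normrZ s1 ?mulr1 // mem_nth.
Qed.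

Lemma l1_nodes_nil K : 0 <= K -> l1_nodes K [::].
Proof. by move=> K0; split=> // a; rewrite /l1sum big_ord0 mulr_ge0. Qed.

Lemma l1_nodes_prefix K s t : 0 <= K -> l1_nodes K (s ++ t) -> l1_nodes K s.
Proof.
move=> K0 [st1 stK]; split=> [x xs|a]; first by apply: st1; rewrite mem_cat xs.
have := stK (fun i => if (i < size s)%N then a i else 0).
rewrite size_cat l1sum_add lincomb_cat.
rewrite (@eq_l1sum _ a (size s)); last by move=> i ->.
rewrite (@eq_lincomb _ a s); last by move=> i ->.
rewrite (@eq_l1sum (fun i => _) (fun=> 0) (size t)); last first.
  by move=> i _; rewrite ltnNge leq_addr.
rewrite (@eq_lincomb (fun i => _) (fun=> 0) t); last first.
  by move=> i _; rewrite ltnNge leq_addr.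
rewrite /l1sum /lincomb [X in _ + X <= _]big1; last by move=> *; rewrite normr0.
by rewrite [X in `|_ + X|]big1 ?addr0 // => *; rewrite scale0r.
Qed.

(** Testing the upper estimate on a single vector of norm 1 gives [1 <= C], hence
    [1 / c <= C / c <= K]. Conversely [1 / K] and 1 are admissible constants. *)
Lemma l1_treeP K s : 1 <= K -> s <> [::] ->
  l1_nodes K s <->
  (forall x, x \in s -> `|x| = 1) /\
  exists c C : R, [/\ 0 < c, 0 < C, c^-1 * C <= K &
    forall a : nat -> R,
      c * (\sum_(i < size s) `|a i|) <= `|\sum_(i < size s) a i *: s`_i|
        <= C * (\sum_(i < size s) `|a i|)].
Proof.
move=> K1 s0; have K0 : 0 < K by exact: lt_le_trans K1.
split=> [[s1 sK]|[s1 [c [C [c0 C0 cCK cC]]]]]; split=> //.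
  exists K^-1, 1; split; rewrite ?invr_gt0 ?invrK ?mulr1 // => a.
  by rewrite mul1r lincomb_le // andbT mulrC ler_pdivrMr // mulrC sK.
move=> a; have C1 : 1 <= C.
  case: s s0 s1 cC => [|x s] // _ s1 /(_ (fun i => (i == 0)%N%:R)).
  rewrite !big_ord_recl /= !big1 ?addr0; last 2 first.
  - by move=> i _; rewrite scale0r.
  - by move=> i _; rewrite normr0.
  by rewrite scale1r normr1 s1 ?mem_head // !mulr1 => /andP[].
have /andP[+ _] := cC a; rewrite -ler_pdivlMl // => /le_trans; apply.
rewrite ler_wpM2r //; apply: le_trans cCK.
by rewrite ler_peMr // invr_ge0 ltW.
Qed.

End L1Nodes.
(** * Well-foundedness in the absence of l1 *)

Section Embedding.
Context {R : realType} {X : completeNormedModType R}.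
Implicit Types (K : R) (A T : set (seq X)) (s t : seq X).

Local Notation drv := (derived (@seq_le R X)).
Local Notation ext := (slt (@seq_le R X)).

Lemma lincomb_mkseq a (x : nat -> X) n :
  lincomb a (mkseq x n) = series (fun i => a i *: x i) n.
Proof.
rewrite /lincomb /series /= size_mkseq big_mkord; apply: eq_bigr => i _.
by rewrite nth_mkseq.
Qed.

(** An infinite sequence whose initial segments are all [K]-nodes spans a copy of
    l1: the series converges absolutely, and the estimates pass to the limit. *)
Lemma contains_l1_of_seq K (x : nat -> X) : 0 < K ->
  (forall n, l1_nodes K (mkseq x n)) -> contains_l1 X.
Proof.
move=> K0 xK.
have x1 i : `|x i| = 1.
  have [h _] := xK i.+1; apply: h; apply/(nthP 0); exists i.
    by rewrite size_mkseq.
  by rewrite nth_mkseq.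
have xcv a : l1 a -> cvgn (series (fun i => a i *: x i)).
  move=> la; apply: normed_cvg.
  rewrite (_ : [normed _] = series (fun i => `|a i|)) //.
  apply/funext => n; rewrite /= /series /=.
  by apply: eq_bigr => i _; rewrite normrZ x1 mulr1.
exists (fun a => limn (series (fun i => a i *: x i))); split.
  move=> k a b la lb; apply/cvg_lim => //.
  rewrite [X in X @ _ --> _](_ : _ = fun n =>
      k *: series (fun i => a i *: x i) n + series (fun i => b i *: x i) n).
    by apply: cvgD; [apply: cvgZr|]; exact: xcv.
  apply/funext => n; rewrite /series /= scaler_sumr -big_split /=.
  by apply: eq_bigr => i _; rewrite scalerDl scalerA.
exists K^-1, 1; split; rewrite ?invr_gt0 // => a la; rewrite mul1r.
have nE n : l1sum a n = series (fun i => `|a i|) n.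
  by rewrite /series /= big_mkord.
have ncv : (fun n => `|series (fun i => a i *: x i) n|) @ \oo -->
    `|limn (series (fun i => a i *: x i))|.
  by apply: cvg_norm; exact: xcv.
have la' : series (fun i => `|a i|) @ \oo --> l1_norm a by [].
apply/andP; split.
  rewrite ler_pdivrMl //.
  apply: (ler_cvg_to la' (cvgMl_tmp ncv)); near=> n.
  have [_ /(_ a)] := xK n; rewrite size_mkseq nE.
  by rewrite lincomb_mkseq.
apply: (ler_cvg_to ncv la'); near=> n.
have [+ _] := xK n => /lincomb_le => /(_ a).
by rewrite size_mkseq nE lincomb_mkseq.
Unshelve. all: by end_near.
Qed.

(** The ranks at which nodes are lost are indexed by the nodes, so they have a
    supremum, and the derived set at this supremum consists of the nodes that
    belong to all derived sets; each of these has a proper extension of the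
    same kind, and choosing repeatedly gives a branch. *)
Lemma derived_all_chain T : (forall a, drv T a !=set0) ->
  exists f : nat -> seq X, forall k, T (f k) /\ ext (f k) (f k.+1).
Proof.
move=> Tall.
have /choice[r rP] t : exists a, drv T a t -> forall b, drv T b t.
  have [h|/existsNP[a ta]] := pselect (forall b, drv T b t).
    by exists ozero.
  by exists a.
(* [r t] is a rank at which [t] is lost, if [t] is lost at all. *)
pose a := osup r.
pose Z : set (seq X) := [set t | forall b, drv T b t].
have aZ : drv T a `<=` Z.
  by move=> t ta b; apply: rP; exact: derived_le (osup_ub r t) _ ta.
have ZZ : forall z : {t | Z t}, exists z' : {t | Z t}, ext (sval z) (sval z').
  move=> [t tZ]; have := tZ (osucc a); rewrite derivedS => -[_ [t' t'a tt']].
  by exists (exist _ t' (aZ _ t'a)).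
have [t0 t0a] := Tall a.
have [g gP] := choice ZZ; pose f k := iter k g (exist _ t0 (aZ _ t0a)).
exists (fun k => sval (f k)) => k; split; last exact: gP.
by have := svalP (f k) ozero; rewrite derived0.
Qed.

(** An infinite branch of a tree of [K]-nodes would provide a copy of l1. *)
Lemma l1_nodes_wf K T : ~ contains_l1 X -> 0 < K -> T `<=` l1_nodes K ->
  exists a, drv T a = set0.
Proof.
move=> no_l1 K0 TK; apply: contrapT => no_a; apply: no_l1.
have [|f fP] := @derived_all_chain T.
  by move=> a; apply/set0P/eqP => a0; apply: no_a; exists a.
pose x i := (f i.+1)`_i.
have pre i j : prefix (f i) (f (i + j)%N).
  elim: j => [|j ih]; first by rewrite addn0 prefix_refl.
  by rewrite addnS; apply: prefix_trans ih _; have [_ []] := fP (i + j)%N.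
have sz i : (i <= size (f i))%N.
  elim: i => // i ih; have [_ /extP[[//|y u] _ ->]] := fP i.
  by rewrite size_cat /= addnS ltnS (leq_trans ih) ?leq_addr.
apply: (@contains_l1_of_seq K x) => // n.
apply: (@l1_nodes_prefix _ _ _ _ (drop n (f n))); first exact: ltW.
suff -> : mkseq x n = take n (f n).
  by rewrite cat_take_drop; apply: TK; have [] := fP n.
apply: (@eq_from_nth _ 0); rewrite size_mkseq ?size_takel // => i ni.
rewrite nth_mkseq // nth_take // /x.
have /prefixP[u ->] : prefix (f i.+1) (f n) by rewrite -(subnKC ni).
by rewrite nth_cat sz.
Qed.

End Embedding.
(** * Block sequences *)

Section Blocks.
Context {R : realType} {X : completeNormedModType R} (e : nat -> X).
Implicit Types (N L : nat) (x y : X) (s t : seq X).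

Definition in_span N L x : Prop :=
  exists2 c : nat -> R, (forall i, c i != 0 -> (N <= i < L)%N) &
    x = \sum_(i < L) c i *: e i.

(** Successive supports, described by the successive end points of the
    intervals that contain them; [N] and [L] are kept so that block sequences can
    be concatenated. *)
Fixpoint blocks N s L : Prop :=
  if s is x :: s' then exists M, [/\ (N <= M)%N, in_span N M x & blocks M s' L]
  else (N <= L)%N.

Lemma span_coord_widen (c : nat -> R) N L L' :
    (forall i, c i != 0 -> (N <= i < L)%N) -> (L <= L')%N ->
  \sum_(i < L) c i *: e i = \sum_(i < L') c i *: e i.
Proof.
move=> cNL /subnKC <-; rewrite big_split_ord /= [X in _ + X]big1 ?addr0 // => i _.
have [->|/cNL] := eqVneq (c (L + i)%N) 0; first by rewrite scale0r.
by rewrite ltnNge leq_addr andbF.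
Qed.

Lemma in_span_widen N N' L L' x : (N' <= N)%N -> (L <= L')%N ->
  in_span N L x -> in_span N' L' x.
Proof.
move=> NN LL [c cNL ->]; exists c; last exact: span_coord_widen cNL LL.
by move=> i /cNL/andP[Ni iL]; rewrite (leq_trans NN) //= (leq_trans iL).
Qed.

Lemma in_span0 N L : in_span N L 0.
Proof.
exists (fun=> 0); first by move=> i /eqP.
by rewrite big1 // => i _; rewrite scale0r.
Qed.

Lemma in_spanP N L k x y : in_span N L x -> in_span N L y ->
  in_span N L (k *: x + y).
Proof.
move=> [c cNL ->] [d dNL ->]; exists (fun i => k * c i + d i).
  move=> i; have [ci0|/cNL //] := eqVneq (c i) 0.
  have [di0|/dNL //] := eqVneq (d i) 0.
  by rewrite ci0 di0 mulr0 addr0 eqxx.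
rewrite scaler_sumr -big_split; apply: eq_bigr => i _.
by rewrite scalerDl scalerA.
Qed.

Lemma in_spanZ N L k x : in_span N L x -> in_span N L (k *: x).
Proof. by move=> h; rewrite -[k *: x]addr0; apply: in_spanP h (in_span0 N L). Qed.

Lemma in_span_lt N L x : in_span N L x -> x != 0 -> (N < L)%N.
Proof.
move=> [c cNL ->]; apply: contraNltn => LN; apply/eqP; apply: big1 => i _.
have [->|/cNL/andP[Ni iL]] := eqVneq (c i) 0; first by rewrite scale0r.
by have := leq_trans (leq_trans iL LN) Ni; rewrite ltnn.
Qed.

Lemma blocks_le N s L : blocks N s L -> (N <= L)%N.
Proof.
by elim: s N => [//|x s ih] N [M [NM _ /ih]]; exact: leq_trans.
Qed.

Lemma blocks_cat N s M t L :
  blocks N s M -> blocks M t L -> blocks N (s ++ t) L.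
Proof.
move=> + tML; elim: s N => [|x s ih] N /=.
  case: t tML => [|y t] /= tML NM; first exact: leq_trans tML.
  have [P [MP yP tP]] := tML; exists P; split=> //; first exact: leq_trans MP.
  exact: in_span_widen yP.
by move=> [P [NP xP sP]]; exists P; split=> //; exact: ih.
Qed.

Lemma blocks_widen N N' s L : (N' <= N)%N -> blocks N s L -> blocks N' s L.
Proof. by move=> NN; apply: (@blocks_cat _ [::]). Qed.

(** A non-zero vector occupies at least one index, so each dropped vector moves
    the starting index by at least one. *)
Lemma blocks_drop N k s L : (forall x, x \in s -> x != 0) -> (k <= size s)%N ->
  blocks N s L -> blocks (N + k) (drop k s) L.
Proof.
elim: k N s => [|k ih] N s s0 ks; first by rewrite addn0 drop0.
case: s s0 ks => [//|x s] s0 ks [M [NM xM sM]] /=.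
have NM' : (N < M)%N by apply: in_span_lt xM _; apply: s0; rewrite mem_head.
apply: (@blocks_widen (M + k)); first by rewrite addnS -addSn leq_add2r.
by apply: ih => // y ys; apply: s0; rewrite inE ys orbT.
Qed.

Lemma blocks_lincomb N s L a : blocks N s L -> in_span N L (lincomb a s).
Proof.
elim: s N a => [|x s ih] N a; first by rewrite /lincomb big_ord0 => _; exact: in_span0.
move=> [M [NM xM sM]]; rewrite -cat1s lincomb_cat.
rewrite {1}/lincomb big_ord1 /=; apply: in_spanP.
  by apply: in_span_widen xM => //; exact: blocks_le sM.
by apply: in_span_widen (ih _ _ sM).
Qed.

Lemma block_basis_of_blocks N s L : (forall x, x \in s -> x != 0) ->
  blocks N s L -> block_basis e s.
Proof.
move=> s0 sNL.
suff [c [cs c_succ _]] : exists c : nat -> nat -> R,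
  [/\ forall j, (j < size s)%N -> s`_j = \sum_(i < L) c j i *: e i,
      forall j k i i', (j < k)%N -> (k < size s)%N ->
         c j i != 0 -> c k i' != 0 -> (i < i')%N &
      forall j i, (j < size s)%N -> c j i != 0 -> (N <= i)%N].
  exists L, c; split=> [j js|j k jk ks i i' _ _ /eqP ci /eqP ci']; last exact: c_succ ci ci'.
  by split; [exact: cs|apply/eqP/s0; rewrite mem_nth].
elim: s N s0 sNL => [|x s ih] N s0 sNL; first by exists (fun=> fun=> 0); split.
have [M [NM xM sM]] := sNL.
have [|c [cs c_succ cM]] := ih M _ sM.
  by move=> y ys; apply: s0; rewrite inE ys orbT.
have [d dNM xd] := xM.
exists (fun j => if j is j.+1 then c j else d); split.
- move=> [|j] /= js; last exact: cs.
  by rewrite xd (span_coord_widen dNM (blocks_le sM)).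
- move=> [|j] [|k] // i i' jk ks; last exact: c_succ.
  by move=> /dNM/andP[_ iM] /cM; move/(_ ks); exact: leq_trans.
- move=> [|j] i js; first by move=> /dNM/andP[].
  by move=> /cM; move/(_ js); exact: leq_trans.
Qed.

(** The [j]-th interval starts after every index used by the vectors before it. *)
Lemma blocks_of_block_basis s : block_basis e s -> exists L, blocks 0 s L.
Proof.
move=> [N [c [cs c_succ]]].
pose p j := \max_(k < j) \max_(i < N | c k i != 0%R) i.+1.
have p_ge j k i : (k < j)%N -> (i < N)%N -> c k i != 0 -> (i < p j)%N.
  move=> kj iN ci; apply: leq_trans (leq_bigmax (Ordinal kj)).
  exact: (@leq_bigmax_cond _ _ (fun i : 'I_N => i.+1) (Ordinal iN)).
have pN j : (p j <= N)%N by apply/bigmax_leqP => k _; apply/bigmax_leqP => i _.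
have p_le j i : (j < size s)%N -> (i < N)%N -> c j i != 0 -> (p j <= i)%N.
  move=> js iN ci; apply/bigmax_leqP => -[k kj] _; apply/bigmax_leqP => -[i' i'N] /= ci'.
  by apply: (c_succ k j) => //; exact/eqP.
have p_mon j : (p j <= p j.+1)%N.
  apply/bigmax_leqP => k _; apply/bigmax_leqP => i ci; apply: (p_ge _ k) => //.
  by apply: ltnW; rewrite ltnS.
have sp j : (j < size s)%N -> in_span (p j) (p j.+1) s`_j.
  move=> js; exists (fun i => if (i < N)%N then c j i else 0).
    move=> i; case: ifP => [iN ci|_]; last by rewrite eqxx.
    by rewrite p_le //= (p_ge _ j).
  have [-> _] := cs j js.
  have cN : forall i, (if (i < N)%N then c j i else 0) != 0 -> (0 <= i < p j.+1)%N.
    by move=> i; case: ifP => [iN ci|_]; [rewrite (p_ge _ j)|rewrite eqxx].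
  rewrite (span_coord_widen cN (pN _)).
  by apply: eq_bigr => i _; rewrite ltn_ord.
exists (p (size s)); have <- : p 0%N = 0%N by rewrite /p big_ord0.
move: (p) p_mon sp; elim: (s) => [q _ _|x t ih q q_mon qt]; first exact: leqnn.
exists (q 1%N).
split=> //; first exact: (qt 0%N).
by apply: (ih (fun j => q j.+1)) => // j; exact: (qt j.+1).
Qed.

End Blocks.
(** * The basis constant *)

Section GeometricSequences.
Context {R : realType} {V : completeNormedModType R}.

(** The total variation after the index [j] is the tail of a geometric series. *)
Lemma geometric_dist (u : nat -> V) (C : R) : 0 <= C ->
  (forall j, `|u j.+1 - u j| <= C * 2^-1 ^+ j) ->
  forall j k, `|u (j + k)%N - u j| <= C * 2 * 2^-1 ^+ j.
Proof.
move=> C0 uC j k.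
suff h : `|u (j + k)%N - u j| <= C * 2 * (2^-1 ^+ j - 2^-1 ^+ (j + k)).
  apply: le_trans h _; rewrite ler_wpM2l ?mulr_ge0 //.
  by rewrite gerBl exprn_ge0 // invr_ge0.
elim: k => [|k ih]; first by rewrite addn0 !subrr normr0 mulr0.
rewrite addnS -[u _ - u j](subrKA (u (j + k)%N)).
apply: le_trans (ler_normD _ _) _; rewrite addrC.
apply: le_trans (lerD ih (uC _)) _.
rewrite exprS; set z := _ ^+ (j + k); set y := _ ^+ j; clear.
by rewrite le_eqVlt; apply/orP; left; apply/eqP; field.
Qed.

Lemma geometric_cvg (u : nat -> V) (C : R) : 0 <= C ->
  (forall j, `|u j.+1 - u j| <= C * 2^-1 ^+ j) -> cvgn u.
Proof.
move=> C0 uC; rewrite (_ : u = fun n => u 0%N + series (telescope u) n); last first.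
  by apply/funext => n; exact: eq_sum_telescope.
apply: is_cvgD; first exact: is_cvg_cst.
apply: normed_cvg; apply: (@series_le_cvg _ _ (geometric C 2^-1)) => //=.
- by move=> n; rewrite mulr_ge0 // exprn_ge0 // invr_ge0.
- by apply: is_cvg_geometric_series; rewrite ger0_norm ?invr_ge0 // invf_lt1 // ltr1n.
Qed.

End GeometricSequences.

Section Basis.
Context {R : realType} {X : completeNormedModType R} {e : nat -> X}.
Hypothesis e_basis : schauder_basis e.
Implicit Types (x y : X).

Definition basis_coef x : nat -> R := projT1 (cid (e_basis x)).

Lemma basis_coef_cvg x : series (fun i => basis_coef x i *: e i) @ \oo --> x.
Proof. by have [] := projT2 (cid (e_basis x)). Qed.

Lemma basis_coef_unique x a : series (fun i => a i *: e i) @ \oo --> x -> basis_coef x = a.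
Proof. by have [_] := projT2 (cid (e_basis x)); exact. Qed.

Lemma basis_coefP k x y i : basis_coef (k *: x + y) i = k * basis_coef x i + basis_coef y i.
Proof.
suff -> : basis_coef (k *: x + y) = fun i => k * basis_coef x i + basis_coef y i by [].
apply: basis_coef_unique.
rewrite [X in X @ _ --> _](_ : _ = fun n =>
    k *: series (fun i => basis_coef x i *: e i) n + series (fun i => basis_coef y i *: e i) n).
  by apply: cvgD; [apply: cvgZl_tmp|]; exact: basis_coef_cvg.
apply/funext => n; rewrite /series /= scaler_sumr -big_split /=.
by apply: eq_bigr => j _; rewrite scalerDl scalerA.
Qed.

Definition basis_proj n x : X := \sum_(i < n) basis_coef x i *: e i.

Lemma basis_proj_cvg x : basis_proj^~ x @ \oo --> x.
Proof.
rewrite (_ : basis_proj^~ x = series (fun i => basis_coef x i *: e i)); first exact: basis_coef_cvg.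
by apply/funext => n; rewrite /series /= big_mkord.
Qed.

Lemma basis_projP n k x y : basis_proj n (k *: x + y) = k *: basis_proj n x + basis_proj n y.
Proof.
rewrite /basis_proj scaler_sumr -big_split; apply: eq_bigr => i _ /=.
by rewrite basis_coefP scalerDl scalerA.
Qed.

Lemma basis_proj0 n : basis_proj n 0 = 0.
Proof. by have := basis_projP n (-1) 0 0; rewrite scaler0 addr0 scaleN1r addNr. Qed.

Lemma basis_projZ n k x : basis_proj n (k *: x) = k *: basis_proj n x.
Proof. by rewrite -[k *: x]addr0 basis_projP basis_proj0 addr0. Qed.

Lemma basis_projB n x y : basis_proj n (x - y) = basis_proj n x - basis_proj n y.
Proof. by rewrite addrC -scaleN1r basis_projP scaleN1r addrC. Qed.

Lemma basis_coefB x y i : basis_coef (x - y) i = basis_coef x i - basis_coef y i.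
Proof. by rewrite addrC -scaleN1r basis_coefP mulN1r addrC. Qed.

Lemma basis_neq0 i : e i != 0.
Proof.
apply/eqP => ei0.
have c0 : series (fun j => (0 : R) *: e j) @ \oo --> (0 : X).
  rewrite (_ : series _ = fun=> 0); first exact: cvg_cst.
  by apply/funext => n; rewrite /series /= big1 // => j _; rewrite scale0r.
have c1 : series (fun j => ((j == i)%:R : R) *: e j) @ \oo --> (0 : X).
  rewrite (_ : series _ = fun=> 0); first exact: cvg_cst.
  apply/funext => n; rewrite /series /= big1 // => j _.
  by case: eqP => [->|_]; rewrite ?ei0 ?scaler0 // scale0r.
have := basis_coef_unique c1; rewrite (basis_coef_unique c0) => /(congr1 (fun f => f i)) /=.
by rewrite eqxx => /esym/eqP; rewrite oner_eq0.
Qed.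

Lemma basis_coef_span N L (c : nat -> R) : (forall i, c i != 0 -> (N <= i < L)%N) ->
  basis_coef (\sum_(i < L) c i *: e i) = c.
Proof.
move=> cNL; apply: basis_coef_unique; apply: cvg_near_cst; near=> n.
rewrite /series /= big_mkord; apply/esym/(span_coord_widen _ cNL).
near: n; exact: nbhs_infty_ge.
Unshelve. all: by end_near.
Qed.

(** Every expansion has bounded partial sums, so the sets [A k] of vectors with
    partial sums bounded by [k] cover the space. By the Baire category theorem
    the closure of one of them contains a ball; differences of its members then
    approximate every vector of a ball around 0. *)
Lemma basis_proj_dense_bounded : exists (r : R) (k : R), [/\ 0 < r, 0 < k &
  forall y eps, `|y| < r -> 0 < eps ->
    exists2 z, `|y - z| < eps & forall n, `|basis_proj n z| <= k].
Proof.
pose A (k : nat) := [set x : X | forall n, `|basis_proj n x| <= k%:R].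
have [k Ak] : exists k, ~ dense (~` closure (A k)).
  apply: contrapT => noA.
  have dA : dense (\bigcap_k ~` closure (A k)).
    apply: Baire => k; split; first exact/closed_openC/closed_closure.
    by apply: contrapT => Ak; apply: noA; exists k.
  have [x [_ xA]] := dA setT (ex_intro _ 0 I) openT.
  have /cvg_seq_bounded/pinfty_ex_gt0[M M0 Mx] : cvgn (basis_proj^~ x).
    by apply/cvg_ex; exists x; exact: basis_proj_cvg.
  have := xA (Num.truncn M).+1 I; apply; apply: subset_closure => n.
  by apply: le_trans (Mx n I) _; apply/ltW/Num.Theory.truncnS_gt.
have [W [[x0 [oW Wx0]] WA]] := denseNE Ak.
have WcA : W `<=` closure (A k).
  move=> x Wx; apply: contrapT => nx.
  by have : (W `&` ~` closure (A k)) x by []; rewrite WA.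
have /nbhs_ballP[r /= r0 xrW] : nbhs x0 W by exact: open_nbhs_nbhs.
have approx x (eps : R) : closure (A k) x -> 0 < eps -> exists2 a, A k a & `|x - a| < eps.
  move=> cx eps0; have [a [Aa xa]] := cx (ball x eps) (nbhsx_ballx x _ eps0).
  by exists a => //; move: xa; rewrite -ball_normE.
exists r, (k%:R + k%:R + 1); split=> // y eps yr eps0.
have eps2 : 0 < eps / 2 by rewrite divr_gt0.
have [a Aa xa] := approx x0 _ (WcA _ Wx0) eps2.
have [|b Ab xb] := approx (x0 + y) _ _ eps2.
  apply/WcA/xrW; rewrite -ball_normE /= opprD addrA subrr add0r normrN //.
exists (b - a) => [|n].
  rewrite (_ : y - (b - a) = (x0 + y - b) - (x0 - a)).
    apply: le_lt_trans (ler_normB _ _) _.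
    by rewrite [eps]splitr; exact: ltrD.
  by rewrite [x0 + y]addrC [y + x0 - b]addrAC addrKA opprK opprB addrA addrAC.
rewrite basis_projB; apply: le_trans (ler_normB _ _) _.
by apply: ler_wpDr => //; apply: lerD.
Qed.

End Basis.
Section BasisConstant.
Context {R : realType} {X : completeNormedModType R} {e : nat -> X}.
Hypothesis e_basis : schauder_basis e.
Implicit Types (x y : X).

Local Notation basis_coef := (basis_coef e_basis).
Local Notation basis_proj := (basis_proj e_basis).

(** Rescaling turns the approximation on a ball into a halving step, to be
    iterated. *)
Lemma basis_proj_half_approx : exists2 M : R, 0 <= M & forall y,
  exists z, `|y - z| <= `|y| / 2 /\ forall n, `|basis_proj n z| <= M * `|y|.
Proof.
have [r [k [r0 k0 kP]]] := basis_proj_dense_bounded e_basis.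
exists (2 * k / r) => [|y]; first by rewrite divr_ge0 ?mulr_ge0 ?ltW.
have [->|y0] := eqVneq y 0.
  exists 0; rewrite subrr normr0 mul0r; split=> // n.
  by rewrite basis_proj0 normr0 mulr0.
have ny : 0 < `|y| by rewrite normr_gt0.
pose l : R := r / (2 * `|y|); have l0 : 0 < l by rewrite divr_gt0 ?mulr_gt0.
have [||z yz kz] := kP (l *: y) (r / 4).
- rewrite normrZ gtr0_norm // (_ : l * _ = r / 2); last first.
    by rewrite /l; field; rewrite gt_eqF.
  by rewrite ltr_pdivrMr // ltr_pMr // ltr1n.
- by rewrite divr_gt0.
exists (l^-1 *: z); split=> [|n].
  rewrite (_ : y - _ = l^-1 *: (l *: y - z)); last first.
    by rewrite scalerBr scalerA mulVf ?gt_eqF // scale1r.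
  rewrite normrZ gtr0_norm ?invr_gt0 // ler_pdivrMl //.
  apply: ltW; apply: lt_le_trans yz _.
  rewrite /l le_eqVlt; apply/orP; left; apply/eqP; field.
  by rewrite gt_eqF.
rewrite basis_projZ normrZ gtr0_norm ?invr_gt0 // ler_pdivrMl //.
apply: le_trans (kz n) _.
rewrite /l le_eqVlt; apply/orP; left; apply/eqP; field.
by rewrite !gt_eqF.
Qed.

(** The argument is that of the open mapping theorem. Repeated halving writes [x]
    as the limit of sums [s j] of vectors whose projections are bounded by a
    geometric sequence, uniformly in the number of coordinates. So the
    coordinates of [s j] converge as [j] grows; the uniform bound allows the two limits to be exchanged, so the limits are the
    coordinates of [x], by uniqueness of the expansion, and the bound survives. *)
Lemma basis_constant : exists2 M : R, 0 <= M & forall n x, `|basis_proj n x| <= M * `|x|.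
Proof.
have [M M0 /choice[Z ZP]] := basis_proj_half_approx.
exists (2 * M) => [|n x]; first by rewrite mulr_ge0.
pose y j := iter j (fun y => y - Z y) x; pose s j := x - y j.
have y_le j : `|y j| <= `|x| * 2^-1 ^+ j.
  elim: j => [|j ih]; first by rewrite mulr1.
  rewrite /y iterS -/(y j); have [h _] := ZP (y j); apply: le_trans h _.
  by rewrite exprSr mulrA ler_wpM2r // invr_ge0.
pose C := M * `|x|; have C0 : 0 <= C by rewrite mulr_ge0.
have s_S j : s j.+1 - s j = Z (y j).
  by rewrite /s [x - y j.+1]addrC addrKA opprK addrC {2}/y iterS -/(y j) subKr.
have s_step m j : `|basis_proj m (s j.+1) - basis_proj m (s j)| <= C * 2^-1 ^+ j.
  rewrite -basis_projB s_S; have [_ h] := ZP (y j); apply: le_trans (h m) _.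
  by rewrite /C -mulrA ler_wpM2l.
have half_cvg0 (c : R) : (fun j => c * 2^-1 ^+ j) @ \oo --> (0 : R).
  by apply: cvg_geometric; rewrite ger0_norm ?invr_ge0 // invf_lt1 // ltr1n.
have s_cvg : s @ \oo --> x.
  apply/cvgrPdist_lt => eps eps0.
  have /cvgrPdist_lt/(_ eps eps0) := half_cvg0 `|x|; apply: filterS => j.
  rewrite sub0r normrN /s subKr => h; apply: le_lt_trans (y_le j) _.
  exact: le_lt_trans (ler_norm _) h.
have coef_s_cvg i : cvgn (fun j => basis_coef (s j) i).
  have ei : 0 < `|e i| by rewrite normr_gt0 basis_neq0.
  apply: (@geometric_cvg R R^o _ (C * 2 / `|e i|)) => [|j].
    by rewrite divr_ge0 ?mulr_ge0.
  rewrite mulrAC ler_pdivlMr // -normrZ.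
  have -> : (basis_coef (s j.+1) i - basis_coef (s j) i) *: e i =
      (basis_proj i.+1 (s j.+1) - basis_proj i.+1 (s j)) -
      (basis_proj i (s j.+1) - basis_proj i (s j)).
    by rewrite -!basis_projB /basis_proj big_ord_recr addrAC subrr add0r basis_coefB.
  apply: le_trans (ler_normB _ _) _; apply: le_trans (lerD (s_step _ _) (s_step _ _)) _.
  by rewrite -mulrDl (_ : C + C = C * 2) //; ring.
pose b i := limn (fun j => basis_coef (s j) i).
pose w m : X := \sum_(i < m) b i *: e i.
have proj_s_cvg m : (fun j => basis_proj m (s j)) @ \oo --> w m.
  rewrite /w /basis_proj; elim: m => [|m ih].
    by under eq_fun do rewrite big_ord0; rewrite big_ord0; exact: cvg_cst.
  under eq_fun do rewrite big_ord_recr; rewrite big_ord_recr /=.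
  by apply: cvgD => //; apply: cvgZr_tmp; exact: coef_s_cvg.
have w_dist m j : `|w m - basis_proj m (s j)| <= C * 2 * 2^-1 ^+ j.
  have h : (fun k => `|basis_proj m (s k) - basis_proj m (s j)|) @ \oo -->
      `|w m - basis_proj m (s j)|.
    by apply: cvg_norm; apply: cvgB; [exact: proj_s_cvg|exact: cvg_cst].
  apply: (ler_cvg_to h (cvg_cst _)); near=> k.
  have jk : (j <= k)%N by near: k; exact: nbhs_infty_ge.
  by rewrite -(subnKC jk); exact: (geometric_dist C0 (s_step m)).
have coef_x : basis_coef x = b.
  apply: basis_coef_unique; rewrite (_ : series _ = w); last first.
    by apply/funext => m; rewrite /series /= big_mkord.
  apply/cvgrPdist_lt => eps eps0.
  have eps3 : 0 < eps / 3 by rewrite divr_gt0.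
  have [j [jx jC]] : exists j, `|x - s j| < eps / 3 /\ C * 2 * 2^-1 ^+ j < eps / 3.
    have /cvgrPdist_lt/(_ _ eps3) h1 := s_cvg.
    have /cvgrPdist_lt/(_ _ eps3) h2 := half_cvg0 (C * 2).
    have [j _ /(_ j (leqnn j)) [h3 h4]] := filterI h1 h2; exists j; split=> //.
    by move: h4; rewrite sub0r normrN; apply: le_lt_trans; exact: ler_norm.
  have /cvgrPdist_lt/(_ _ eps3) := @basis_proj_cvg _ _ _ e_basis (s j).
  apply: filterS => m sm.
  rewrite (_ : x - w m = (x - s j) + (s j - basis_proj m (s j)) -
                         (w m - basis_proj m (s j))); last first.
    by rewrite addrA subrK opprB addrA subrK.
  apply: le_lt_trans (ler_normB _ _) _.
  apply: le_lt_trans (lerD (ler_normD _ _) (w_dist m j)) _.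
  by rewrite [eps](_ : _ = eps / 3 + eps / 3 + eps / 3) ?ltrD //; field.
have <- : w n = basis_proj n x by rewrite /basis_proj coef_x.
have := w_dist n 0%N; rewrite /s /y /= subrr basis_proj0 subr0 mulr1.
by rewrite /C mulrC mulrA.
Unshelve. all: by end_near.
Qed.

End BasisConstant.
(** * Gluing block nodes *)

Section BlockNodes.
Context {R : realType} {X : completeNormedModType R}.
Implicit Types (K : R) (s t u : seq X) (a b c : ord).

Local Notation drv := (derived (@seq_le R X)).
Local Notation ext := (slt (@seq_le R X)).

Lemma lincomb_cons d (x : X) u :
  lincomb d (x :: u) = d 0%N *: x + lincomb (fun i => d i.+1) u.
Proof. by rewrite /lincomb big_ord_recl. Qed.

Lemma lincombZ k d u : lincomb (fun i => k * d i) u = k *: lincomb d u.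
Proof.
by rewrite /lincomb scaler_sumr; apply: eq_bigr => i _; rewrite scalerA.
Qed.

Lemma l1_nodes_suffix K s t : l1_nodes K (s ++ t) -> l1_nodes K t.
Proof.
move=> [st1 stK]; split=> [x xt|a]; first by apply: st1; rewrite mem_cat xt orbT.
have := stK (fun i => if (size s <= i)%N then a (i - size s)%N else 0).
rewrite size_cat l1sum_add lincomb_cat.
rewrite (@eq_l1sum _ (fun i => _) (fun=> 0) (size s)); last first.
  by move=> i si; rewrite leqNgt si.
rewrite (@eq_lincomb _ _ (fun i => _) (fun=> 0) s); last first.
  by move=> i si; rewrite leqNgt si.
rewrite (@eq_l1sum _ (fun i => _) a (size t)); last first.
  by move=> i _; rewrite leq_addr addKn.
rewrite (@eq_lincomb _ _ (fun i => _) a t); last first.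
  by move=> i _; rewrite leq_addr addKn.
rewrite {1}/l1sum /lincomb [X in X + _ <= _]big1; last by move=> *; rewrite normr0.
by rewrite [X in `|X + _|]big1 ?add0r // => *; rewrite scale0r.
Qed.

Lemma l1_nodes_neq0 K s x : l1_nodes K s -> x \in s -> x != 0.
Proof. by move=> [s1 _] /s1 x1; rewrite -normr_gt0 x1. Qed.

Variable e : nat -> X.

Definition block_nodes K N : set (seq X) :=
  [set s : seq X | l1_nodes K s /\ exists L, blocks e N s L].

Lemma block_nodes_nil K N : 0 <= K -> block_nodes K N [::].
Proof. by move=> K0; split; [exact: l1_nodes_nil|exists N => /=]. Qed.

(** Dropping the first [N] vectors of a node pushes its blocks beyond the index
    [N]. It costs [N] derivations, which a limit rank can afford. *)
Lemma derived_block_tail K b N : 0 <= K ->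
    (forall c, olt c b -> olt (osucc c) b) ->
  drv (block_nodes K 0) b [::] -> drv (block_nodes K N) b [::].
Proof.
move=> K0 b_lim h; apply/derivedP; split=> [|c cb]; first exact: block_nodes_nil.
have cNb : olt (oadd c (iter N.+1 osucc ozero)) b.
  elim: N.+1 => [|k ih]; first exact: ole_lt_trans (proj1 (oadd0 c)) cb.
  rewrite iterS; apply: ole_lt_trans (b_lim _ ih); exact: (proj1 (oaddS _ _)).
have [u Nu /= uc] := derived_add_nat (derived_le (oltW cNb) h).
exists (drop N u).
  apply/extP; exists (drop N u) => // /(congr1 size)/eqP.
  by rewrite size_drop subn_eq0 leqNgt Nu.
apply: (@derived_sim _ _ (block_nodes K 0) (block_nodes K N)
  (fun s t => [/\ block_nodes K 0 s, (N <= size s)%N & t = drop N s])) (uc).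
- move=> s _ [[sK [L sL]] Ns ->]; split.
    by apply: (@l1_nodes_suffix _ (take N s)); rewrite cat_take_drop.
  exists L; rewrite -[N in blocks e N]add0n; apply: blocks_drop => // x.
  exact: l1_nodes_neq0 sK.
- move=> s _ s' [_ Ns ->] s'K /extP[v v0 s'E]; exists (drop N s').
    by apply/extP; exists v => //; rewrite s'E -{1}(cat_take_drop N s) -catA;
      rewrite drop_size_cat ?size_takel.
  by split=> //; rewrite s'E size_cat (leq_trans Ns) ?leq_addr.
- by split=> //; [exact: derived_sub uc|exact: ltnW].
Qed.

Hypothesis e_basis : schauder_basis e.

(** The projection onto the first [L] coordinates recovers the part carried by
    [s]. Its norm bounds this part, and one more than its norm the part carried
    by [t], so the two l1 estimates add up. *)
Lemma block_nodes_cat M K1 K2 N L s t :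
    0 <= K1 -> 0 <= K2 -> (forall n x, `|basis_proj e_basis n x| <= M * `|x|) ->
    l1_nodes K1 s -> blocks e N s L -> block_nodes K2 L t ->
  block_nodes (K1 * M + K2 * (1 + M)) N (s ++ t).
Proof.
move=> K10 K20 projM [s1 sK] sL [[t1 tK] [L' tL]]; split; last first.
  by exists L'; exact: blocks_cat tL.
split=> [x|a]; first by rewrite mem_cat => /orP[/s1|/t1].
rewrite size_cat l1sum_add lincomb_cat; set a' := fun i => _.
set u := lincomb a s; set v := lincomb a' t.
have [c cNL uE] : in_span e 0 L u by apply: in_span_widen (blocks_lincomb a sL).
have [d dNL vE] : in_span e L L' v := blocks_lincomb a' tL.
have projuv : basis_proj e_basis L (u + v) = u.
  rewrite [RHS]uE /basis_proj; apply: eq_bigr => i _; congr (_ *: _).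
  rewrite -[u]scale1r basis_coefP mul1r uE vE !(basis_coef_span _ cNL).
  rewrite (basis_coef_span _ dNL); have [->|/dNL] := eqVneq (d i) 0.
    by rewrite addr0.
  by rewrite leqNgt ltn_ord.
have uM : `|u| <= M * `|u + v| by rewrite -{1}projuv.
have vM : `|v| <= (1 + M) * `|u + v|.
  rewrite -[v in `|v|](addKr u) addrC; apply: le_trans (ler_normB _ _) _.
  by rewrite mulrDl mul1r lerD2l.
rewrite mulrDl -!mulrA; apply: lerD.
  by apply: le_trans (sK a) _; rewrite ler_wpM2l.
by apply: le_trans (tK a') _; rewrite ler_wpM2l.
Qed.

(** The rank [b] is attained beyond every index with the same constant: this is
    what can be glued repeatedly. *)
Definition cofinal_rank b : Prop :=
  exists2 K, 1 <= K & forall N, drv (block_nodes K N) b [::].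

Lemma cofinal_rank_le a b : ole a b -> cofinal_rank b -> cofinal_rank a.
Proof. by move=> ab [K K1 h]; exists K => // N; exact: derived_le ab _ (h N). Qed.

Lemma cofinal_rank1 : cofinal_rank (osucc ozero).
Proof.
exists 1 => // N; rewrite derivedS derived0; split; first exact: block_nodes_nil.
have eN : 0 < `|e N| by rewrite normr_gt0 basis_neq0.
pose x := `|e N|^-1 *: e N.
have x1 : `|x| = 1 by rewrite normrZ gtr0_norm ?invr_gt0 // mulVf ?gt_eqF.
exists [:: x]; last by apply/extP; exists [:: x].
split; last first.
  exists N.+1 => /=; exists N.+1; split=> //.
  exists (fun i => if i == N then `|e N|^-1 else 0).
    by move=> i; case: (i =P N) => [->|_]; rewrite ?leqnn // eqxx.
  rewrite big_ord_recr /= eqxx big1 ?add0r // => i _.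
  by rewrite ltn_eqF ?scale0r.
split=> [y|a]; first by rewrite inE => /eqP ->.
by rewrite /l1sum /lincomb /= !big_ord1 /= normrZ x1 mulr1 mul1r.
Qed.

(** On top of a node with blocks ending at [L], a set of block nodes beyond [L]
    is glued. The constant depends on the two given ones and on the basis
    constant, not on the nodes. *)
Lemma cofinal_rank_add b a :
  cofinal_rank b -> cofinal_rank a -> cofinal_rank (oadd b a).
Proof.
move=> [Kb Kb1 hb] [Ka Ka1 ha]; have [M M0 projM] := basis_constant e_basis.
have Ka0 : 0 <= Ka by exact: le_trans ler01 Ka1.
have Kb0 : 0 <= Kb by exact: le_trans ler01 Kb1.
exists (Ka * M + Kb * (1 + M)) => [|N].
  apply: le_trans (_ : 1 <= Kb * (1 + M)) _; first by rewrite mulr_ege1 // lerDl.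
  by rewrite lerDr mulr_ge0.
have /choice[L LP] s : exists L, block_nodes Ka N s -> blocks e N s L.
  have [[_ [L sL]]|h] := pselect (block_nodes Ka N s); last by exists 0%N.
  by exists L.
apply: (@derived_cat _ _ (block_nodes Ka N) _ (fun s => block_nodes Kb (L s))) => //.
move=> s u sA uF; apply: (@block_nodes_cat _ _ _ _ (L s)) => //.
- by case: sA.
- exact: LP.
Qed.

Lemma cofinal_rank_mul_omega a k :
  cofinal_rank a -> cofinal_rank (omul a (iter k osucc ozero)).
Proof.
move=> ha; elim: k => [|k ih]; last first.
  rewrite iterS; apply: cofinal_rank_le (proj1 (omulS _ _)) _.
  exact: cofinal_rank_add.
exact: cofinal_rank_le (ole_trans (proj1 (omul0 a)) (ole0 a)) ha.
Qed.

End BlockNodes.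
(** * From l1 nodes to block nodes *)

Section Shadow.
Context {R : realType} {X : completeNormedModType R} {e : nat -> X}.
Hypothesis e_basis : schauder_basis e.
Implicit Types (K : R) (s t u : seq X) (d : nat -> R).

Local Notation ext := (slt (@seq_le R X)).
Local Notation basis_coef := (basis_coef e_basis).

Lemma basis_coef0 i : basis_coef 0 i = 0.
Proof. by rewrite -[0 in LHS](subrr 0) basis_coefB subrr. Qed.

Lemma basis_coefZ k (x : X) i : basis_coef (k *: x) i = k * basis_coef x i.
Proof. by rewrite -[k *: x]addr0 basis_coefP basis_coef0 addr0. Qed.

Lemma basis_coef_lincomb d u i :
  basis_coef (lincomb d u) i = \sum_(j < size u) d j * basis_coef u`_j i.
Proof.
elim: u d => [|x u ih] d; first by rewrite /lincomb !big_ord0 basis_coef0.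
by rewrite lincomb_cons basis_coefP ih big_ord_recl.
Qed.

(** The [L] conditions are fewer than the unknowns. *)
Lemma exists_lincomb_tail u L : (L < size u)%N ->
  exists2 d : nat -> R, (exists2 j, (j < size u)%N & d j != 0) &
    forall i, (i < L)%N -> basis_coef (lincomb d u) i = 0.
Proof.
move=> Lu; pose A : 'M[R]_(size u, L) := \matrix_(j, i) basis_coef u`_j i.
have : kermx A != 0.
  rewrite kermx_eq0 /row_free; apply: contraTneq Lu => <-.
  by rewrite -leqNgt rank_leq_col.
move=> /rowV0Pn[v /sub_kermxP vA v0].
pose d i := if insub i is Some j then v 0 j else 0.
have dE (j : 'I_(size u)) : d j = v 0 j by rewrite /d valK.
exists d => [|i iL].
  have [j vj] : exists j, v 0 j != 0.
    apply: contrapT => h; move/eqP: v0; apply; apply/rowP => j; rewrite mxE.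
    by apply/eqP; apply: contraT => vj; case: h; exists j.
  by exists j => //; rewrite dE.
rewrite basis_coef_lincomb.
have /rowP/(_ (Ordinal iL)) := vA; rewrite !mxE => {2}<-.
by apply: eq_bigr => j _; rewrite dE mxE.
Qed.

(** Partial sums of the expansion of [y] start at [L], approximate [y] and have
    norm close to 1; normalising one of them costs no more than its distance
    to [y]. *)
Lemma approx_tail (y : X) L eps : `|y| = 1 -> 0 < eps ->
    (forall i, (i < L)%N -> basis_coef y i = 0) ->
  exists z, [/\ `|z| = 1, `|y - z| <= eps &
    exists2 L', (L <= L')%N & in_span e L L' z].
Proof.
move=> y1 eps0 yL; pose delta := Num.min (eps / 2) (1 / 2).
have delta0 : 0 < delta by rewrite lt_min !divr_gt0.
have /cvgrPdist_lt/(_ _ delta0)[m _ /(_ (maxn m L) (leq_maxl _ _)) /=] :=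
  @basis_proj_cvg _ _ _ e_basis y.
set p := basis_proj _ _ _; rewrite lt_min => /andP[yp1 yp2].
have pn : `| `|p| - 1 | <= `|y - p| by rewrite -y1 distrC ler_dist_dist.
have p0 : 0 < `|p|.
  have := le_lt_trans pn yp2; rewrite ltr_norml => /andP[+ _]; lra.
exists (`|p|^-1 *: p); split.
- by rewrite normrZ gtr0_norm ?invr_gt0 // mulVf ?gt_eqF.
- rewrite (_ : y - _ = (y - p) + (1 - `|p|^-1) *: p); last first.
    by rewrite scalerBl scale1r addrA subrK.
  apply: le_trans (ler_normD _ _) _; rewrite [eps]splitr.
  apply: lerD; first exact: ltW.
  rewrite normrZ -[X in _ * X]gtr0_norm // -normrM mulrBl mul1r mulVf ?gt_eqF //.
  by apply: le_trans pn _; exact: ltW.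
- exists (maxn m L); first exact: leq_maxr.
  apply: in_spanZ; exists (fun i => if (i < maxn m L)%N then basis_coef y i else 0).
    move=> i; case: ifP => [im yi|_]; last by rewrite eqxx.
    by rewrite andbT leqNgt; apply: contraNN yi => /yL ->.
  by apply: eq_bigr => i _; rewrite ltn_ord.
Qed.

(** [t] is a perturbed sequence of blocks of [s]: every combination of [t] is
    close to a combination of [s] whose coefficients have at least the same l1
    norm. Because errors are measured against the l1 norm of the coefficients, the same error
    [1 / (2 * K)] is allowed for every vector of [t]. *)
Definition shadow K s t : Prop :=
  [/\ l1_nodes K s, (forall x, x \in t -> `|x| = 1),
      exists L, blocks e 0 t L &
      forall b, exists2 a, l1sum b (size t) <= l1sum a (size s) &
        `|lincomb a s - lincomb b t| <= (2 * K)^-1 * l1sum b (size t)].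

Lemma shadow_nil K : 0 <= K -> shadow K [::] [::].
Proof.
move=> K0; split=> //; first exact: l1_nodes_nil.
  by exists 0%N.
by move=> b; exists b => //; rewrite subrr normr0 /l1sum big_ord0 mulr0.
Qed.

(** The perturbation uses up half of the lower l1 estimate of [s]. *)
Lemma shadow_block K s t : 0 < K -> shadow K s t -> block_nodes e (2 * K) 0 t.
Proof.
move=> K0 [[_ sK] t1 tL st]; split=> //; split=> // b.
have [a ab abt] := st b; have {ab} h := le_trans ab (sK a).
have tri : `|lincomb a s| <= `|lincomb b t| + (2 * K)^-1 * l1sum b (size t).
  rewrite -(subrK (lincomb b t) (lincomb a s)) addrC.
  by apply: le_trans (ler_normD _ _) _; rewrite lerD2l.
have : l1sum b (size t) <=
    K * (`|lincomb b t| + (2 * K)^-1 * l1sum b (size t)).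
  by apply: le_trans h _; rewrite ler_pM2l.
(* The error term contributes half of the left-hand side. *)
rewrite mulrDr mulrA (_ : K * (2 * K)^-1 = 1 / 2); last first.
  by field; rewrite gt_eqF.
by set x := l1sum _ _; set y := `|_|; rewrite -mulrA; set q := K * y; lra.
Qed.

(** With more new vectors than [L], the index where the blocks of [t] end, some
    normalised combination of the new vectors has its first [L] coordinates zero
    and is close to a block beyond [L]. Its coefficients have l1 norm at least 1,
    by the triangle inequality, so that coefficients do not shrink. *)
Lemma shadow_ext K s t : 0 < K -> shadow K s t ->
  exists k, forall u, l1_nodes K (s ++ u) -> (k <= size u)%N ->
    exists2 t', ext t t' & shadow K (s ++ u) t'.
Proof.
move=> K0 [sK t1 [L tL] st]; exists L.+1 => u suK Lu.
have [u1 uK] := l1_nodes_suffix suK.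
have [d [j ju dj] du] := exists_lincomb_tail Lu.
have y0 : 0 < `|lincomb d u|.
  have /lt_le_trans/(_ (uK d)) : 0 < l1sum d (size u).
    rewrite /l1sum (bigD1 (Ordinal ju)) //= ltr_wpDr ?normr_gt0 //.
    by apply: sumr_ge0 => i _.
  by rewrite pmulr_rgt0.
pose d' i := `|lincomb d u|^-1 * d i.
have y1 : `|lincomb d' u| = 1.
  by rewrite lincombZ normrZ gtr0_norm ?invr_gt0 // mulVf ?gt_eqF.
have [|i iL|z [z1 yz [L' LL' zL]]] := @approx_tail _ L (2 * K)^-1 y1.
- by rewrite invr_gt0 mulr_gt0.
- by rewrite lincombZ basis_coefZ du ?mulr0.
have d'1 : 1 <= l1sum d' (size u) by rewrite -y1; exact: lincomb_le.
exists (t ++ [:: z]); first by apply/extP; exists [:: z].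
split=> //.
- by move=> x; rewrite mem_cat inE => /orP[/t1//|/eqP ->].
- by exists L'; apply: blocks_cat tL _ => /=; exists L'.
- move=> b; have [a ab abt] := st b.
  exists (fun i => if (i < size s)%N then a i
                   else b (size t) * d' (i - size s)%N).
    rewrite !size_cat !l1sum_add (@eq_l1sum _ (fun i => _) a (size s)); last first.
      by move=> i ->.
    apply: lerD => //; rewrite {1}/l1sum big_ord1 addn0.
    rewrite (@eq_l1sum _ (fun i => _) (fun i => b (size t) * d' i)); last first.
      by move=> i _; rewrite ltnNge leq_addr /= addKn.
    have -> : l1sum (fun i => b (size t) * d' i) (size u) =
        `|b (size t)| * l1sum d' (size u).
      by rewrite /l1sum mulr_sumr; apply: eq_bigr => i _; rewrite normrM.
    by rewrite ler_peMr.
  rewrite !lincomb_cat size_cat l1sum_add.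
  rewrite (@eq_lincomb _ _ (fun i => _) a s); last by move=> i ->.
  rewrite (@eq_lincomb _ _ (fun i => _) (fun i => b (size t) * d' i) u); last first.
    by move=> i _; rewrite ltnNge leq_addr /= addKn.
  rewrite lincombZ [lincomb _ [:: z]]big_ord1 /l1sum big_ord1 addn0 /= -/(l1sum _ _).
  rewrite opprD addrACA -scalerBr mulrDr.
  apply: le_trans (ler_normD _ _) _; apply: lerD => //.
  by rewrite normrZ mulrC ler_wpM2r.
Qed.

Lemma derived_shadow K b : 0 < K ->
  derived (@seq_le R X) (l1_nodes K) (omul omega b) [::] ->
  derived (@seq_le R X) (block_nodes e (2 * K) 0) b [::].
Proof.
move=> K0; apply: (@derived_omega_sim _ _ _ _ (shadow K)).
- by move=> s t; exact: shadow_block.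
- by move=> s t; exact: shadow_ext.
- by apply: shadow_nil; exact: ltW.
Qed.

End Shadow.

(** * From ranks to the indices *)

Section Indices.
Context {R : realType} {X : completeNormedModType R}.
Implicit Types (A T : set (seq X)) (b c : ord).

Local Notation drv := (derived (@seq_le R X)).
Local Notation ext := (slt (@seq_le R X)).

Lemma prefix_tree T : countable T -> T !=set0 -> is_tree (@seq_le R X) T.
Proof.
move=> cT T0; have take_le (s t : seq X) : seq_le s t -> s = take (size s) t.
  by rewrite /seq_le prefixE => /eqP.
split=> //.
  split=> [s _|s t _ _ st ts|s t u _ _ _]; last exact: prefix_trans.
    exact: prefix_refl.
  rewrite {1}(take_le _ _ st) take_oversize //.
  by have /prefixP[u ->] := ts; rewrite size_cat leq_addr.
move=> s _; split=> [|t u _ _ [/take_le tE _] [/take_le uE _]].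
  apply: (@sub_finite_set _ _ ((fun i => take i s) @` `I_(size s).+1)).
    move=> t [_ [ts _]]; exists (size t); last exact/esym/take_le.
    by have /prefixP[u ->] := ts; rewrite /= ltnS size_cat leq_addr.
  exact/finite_image/finite_II.
rewrite tE uE; have [tu|/ltnW ut] := leqP (size t) (size u); [left|right].
  by rewrite /seq_le -(take_takel _ tu) prefix_take.
by rewrite /seq_le -(take_takel _ ut) prefix_take.
Qed.

(** A rank below the order of a tree is attained by some node, hence also by the
    root. If no derived tree is empty the order is 0 and nothing is below it. *)
Lemma derived_of_tree_order T A b : T `<=` A -> A [::] ->
  olt b (tree_order (@seq_le R X) T) -> drv A b [::].
Proof.
move=> TA A0 bT.
have [t tb] : drv T b !=set0.
  apply/set0P/eqP => Tb; apply: (@olt_irr b).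
  by apply: olt_le_trans bT _; have [_] := @oinfP (fun a => drv T a = set0) b Tb; exact.
have tA := derived_mono TA tb.
case: (eqVneq t [::]) tA => [-> //|t0] tA.
by apply: derived_down tA => //; apply/extP; exists t => //; exact/eqP.
Qed.

Lemma derived_of_l1_index b : olt b (l1_index X) ->
  exists2 K : R, 1 <= K & drv (l1_nodes K) b [::].
Proof.
move=> /olt_osup[[K K1]] /olt_osup[[T /= TK] bT]; exists K => //.
apply: derived_of_tree_order bT; last by apply/l1_nodes_nil/le_trans/K1.
by move=> s Ts; have [[T0 _] /(_ s Ts) h] := TK; apply/l1_treeP => //; exact: T0.
Qed.

Lemma derived_of_block_l1_index (e : nat -> X) b : olt b (block_l1_index e) ->
  exists2 K : R, 1 <= K & drv (block_nodes e K 0) b [::].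
Proof.
move=> /olt_osup[[K K1]] /olt_osup[[T /= [TK Tb]] bT]; exists K => //.
apply: derived_of_tree_order bT; last by apply/block_nodes_nil/le_trans/K1.
move=> s Ts; split; last exact/blocks_of_block_basis/Tb.
by have [[T0 _] /(_ s Ts) h] := TK; apply/l1_treeP => //; exact: T0.
Qed.

(** A countable set of nodes attaining [b] is a tree once the root is removed.
    Since the space does not contain l1 this tree is well-founded, so its order
    is genuine and cannot be below [b]. *)
Lemma block_l1_index_ge (e : nat -> X) (K : R) b :
    ~ contains_l1 X -> 1 <= K -> hcountable b -> drv (block_nodes e K 0) b [::] ->
  ole b (block_l1_index e).
Proof.
move=> no_l1 K1 hb h; have K0 : 0 < K by exact: lt_le_trans K1.
have [b0|b0] := ole_total b ozero; first exact: ole_trans b0 (ole0 _).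
have [S [Sc SB Sb]] := derived_countable hb h.
pose T := S `\` [set [::]].
have TS : T `<=` S by move=> s [].
have STd c t : t <> [::] -> drv S c t -> drv T c t.
  move=> t0 tc.
  apply: (@derived_sim _ _ S T (fun s t => [/\ s = t, S s & s <> [::]])) (tc).
  - by move=> s _ [<-].
  - move=> s _ s' [<- _ s0] Ss' ss'; exists s' => //; split=> //.
    by move: ss' => /extP[u _ ->]; case: s s0.
  - by split=> //; exact: derived_sub tc.
have Tc c : olt c b -> drv T c !=set0.
  move=> cb; move/derivedP: Sb => [_ /(_ c cb)[t /extP[u u0 ->] tc]].
  by exists u; exact: STd.
have T_tree : block_l1_tree e K T.
  have TB s : T s -> block_nodes e K 0 s by move=> /TS/SB.
  split; last first.
    move=> s /TB[sK [L sL]]; apply: block_basis_of_blocks sL => x.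
    exact: l1_nodes_neq0 sK.
  split; last by move=> s Ts; apply/l1_treeP => //; [case: Ts|case: (TB _ Ts)].
  split=> [s []//|]; apply: prefix_tree; last by have [s] := Tc _ b0; rewrite derived0; exists s.
  exact: sub_countable (subset_card_le TS) Sc.
apply: ole_trans (@osup_ub _ _ (exist _ K K1)).
apply: ole_trans (@osup_ub _ _ (exist _ T T_tree)) => /=.
have [//|cb] := ole_total b (tree_order (@seq_le R X) T).
have [a Ta] : exists a, drv T a = set0.
  by apply: (@l1_nodes_wf _ _ K) => // s /TS/SB[].
have [s] := Tc _ cb; have [-> _] := @oinfP (fun a => drv T a = set0) a Ta.
by [].
Qed.

End Indices.
Theorem corollary5p14 (R : realType) (X : completeNormedModType R)
    (e : nat -> X) (n : nat)
    (X_no_l1 : ~ contains_l1 X)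
    (e_basis : schauder_basis e)
    (n_ge1 : (1 <= n)%N)
    (index_X : oeq (l1_index X) (omega_pow n)) :
  exists m : nat,
    (m = n \/ m = (n - 1)%N) /\ oeq (block_l1_index e) (omega_pow m).
Proof.
case: n n_ge1 index_X => [//|m] _ [X_le X_ge]; rewrite subSS subn0.
have ge_of_cofinal b : hcountable b -> cofinal_rank e b -> ole b (block_l1_index e).
  by move=> hb [K K1 h]; exact: block_l1_index_ge (h 0%N).
have block_le : ole (block_l1_index e) (l1_index X).
  apply: osup_least => -[K K1]; apply: (@ole_osup _ _ _ (exist _ K K1)).
  apply: osup_least => -[T [TK Tb]].
  exact: (@osup_ub _ _ (exist _ T TK)).
have [le_m|gt_m] := ole_total (block_l1_index e) (omega_pow m).
  exists m; split; [by right|split=> //].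
  (* For n = 1 the exponent is 0, and omega^0 = 1 is not a limit. *)
  case: m X_ge {X_le le_m} => [_|m X_ge].
    apply: ge_of_cofinal; first exact: hcountable_omega_pow 0%N.
    exact: cofinal_rank1.
  apply/ole_below => x; set b := obelow x.
  have bm : olt b (omega_pow m.+1) by have /ole_below := olexx (omega_pow m.+1); apply.
  (* Strictness comes from a further copy of omega: [b + 1] is still below the
     limit [omega_pow m.+1]. *)
  have wb : olt (omul omega (osucc b)) (l1_index X).
    apply: olt_le_trans X_ge; apply: olt_le_trans (omul_omega_pow_le m.+1).
    apply: olt_le_trans (omul_succ_lt omega (omega_pow_limit bm)).
    apply: ole_lt_trans (proj2 (oadd0 _)) _; apply: oadd_ltr.
    by exists 0%N; exact: olexx.
  have [K K1 /(derived_shadow e_basis) h] := derived_of_l1_index wb.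
  apply/ole_succ; apply: (@block_l1_index_ge _ _ e (2 * K)) => //.
  - by rewrite mulr_ege1 // ler1n.
  - by apply: hcountable_succ; apply: hcountable_below; exact: hcountable_omega_pow.
  - by apply: h; exact: lt_le_trans K1.
exists m.+1; split; [by left|split; first exact: ole_trans X_le].
have cofinal_m : cofinal_rank e (omega_pow m).
  case: m gt_m {X_le X_ge} => [_|m gt_m]; first exact: cofinal_rank1.
  have [K K1 h] := derived_of_block_l1_index gt_m.
  exists K => // N; apply: derived_block_tail h; first exact: le_trans K1.
  by move=> c; exact: omega_pow_limit.
rewrite omega_powS; apply: osup_least => k.
apply: ole_trans (proj2 (omulS _ _)) _; apply: ge_of_cofinal.
  by apply: hcountable_mul; [exact: hcountable_omega_pow|exact: (hcountable_nat k.+1)].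
exact: (cofinal_rank_mul_omega e_basis k.+1).
Qed.
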